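(* Let $s$ be a state at a program position $p$ whose instruction is $\mathtt{pb = getelementptr\ i8,\ i8*\ pa,\ i}m\ t$ (with $t\in\mathcal V_{\mathcal P}\cup\mathbb N$, $\mathtt{pa},\mathtt{pb}\in\mathcal V_{\mathcal P}$), and let $c$ be a concrete state represented by $s$. Let $s'$ be the state resulting from $s$ by applying the list traversal rule, and let $c'$ be the concrete state resulting from $c$ by applying the concrete getelementptr rule (both rules defined in the context). Then $c'$ is represented by $s'$.
   Context: Setting. There are disjoint infinite sets $\mathcal{V}_{\mathcal P}$ (program variables) and $\mathcal{V}_{\mathit{sym}}$ (symbolic variables). Integers are treated as unbounded and unsigned. Every LLVM type $\mathtt{ty}$ has a size $\mathit{size}(\mathtt{ty})\in\mathbb N_{>0}$ in bytes; $\mathtt{ty*}$ is the pointer type to $\mathtt{ty}$ and $\mathtt{i8}$ is the byte type. A program position is a pair $p=(b,i)$ of a basic block and an instruction index, and $p^+=(b,i+1)$. States. A state is either the error state $\mathit{ERR}$ or a tuple $s=(p,\mathit{LV},\mathit{AL},\mathit{PT},\mathit{LI},\mathit{KB})$ where $p$ is a program position; $\mathit{LV}:\mathcal V_{\mathcal P}\rightharpoonup\mathcal V_{\mathit{sym}}$ is a partial injective function (identified with the set of equations $\mathtt{x}=\mathit{LV}(\mathtt{x})$, extended by $\mathit{LV}(n)=n$ for $n\in\mathbb N$; $\mathit{LV}[\mathtt x:=w]$ maps $\mathtt x$ to $w$ and agrees with $\mathit{LV}$ elsewhere); $\mathit{AL}$ is a set of allocations $[\![v_1,v_2]\!]$ with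 $v_1,v_2\in\mathcal V_{\mathit{sym}}$; $\mathit{PT}$ is a set of points-to entries $v_1\hookrightarrow_{\mathtt{ty}}v_2$ with $v_1,v_2\in\mathcal V_{\mathit{sym}}$; $\mathit{LI}$ is a set of list invariants $v_{\mathit{ad}}\hookrightarrow^{v_\ell}_{\mathtt{ty}}[(\mathit{off}_i:\mathtt{ty}_i:v_i..\hat v_i)]_{i=1}^n$ with $n\ge 1$, $v_{\mathit{ad}},v_\ell,v_i,\hat v_i\in\mathcal V_{\mathit{sym}}$, $\mathit{off}_i\in\mathbb N$, LLVM types $\mathtt{ty},\mathtt{ty}_i$, and exactly one index $j$ (the recursive field) with $\mathtt{ty}_j=\mathtt{ty*}$; $\mathit{KB}$ is a set of quantifier-free integer arithmetic formulas over $\mathcal V_{\mathit{sym}}$ (sets of formulas are read as conjunctions). $\mathcal V_{\mathit{sym}}(s)$ is the set of symbolic variables occurring in $s$; a variable is fresh if it does not occur in the state. ''$\models\varphi$'' means validity over the integers. State formula. $\langle s\rangle$ is the smallest set of formulas that contains $\mathit{KB}$ and: $v_1\ge1\wedge v_1\le v_2$ for each $[\![v_1,v_2]\!]\in\mathit{AL}$; $v_2<w_1\vee w_2<v_1$ for all $[\![v_1,v_2]\!],[\![w_1,w_2]\!]\in\mathit{AL}$ with $(v_1,v_2)\ne(w_1,w_2)$; $v_1\ge1$ for each $(v_1\hookrightarrow_{\mathtt{ty}}v_2)\in\mathit{PT}$; $v_2=w_2$ for $(v_1\hookrightarrow_{\mathtt{ty}}v_2),(w_1\hookrightarrow_{\mathtt{ty}}w_2)\in\mathit{PT}$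 with $\models\langle s\rangle\Rightarrow v_1=w_1$; $v_1\ne w_1$ for such entries with $\models\langle s\rangle\Rightarrow v_2\ne w_2$; and for each list invariant $v_{\mathit{ad}}\hookrightarrow^{v_\ell}_{\mathtt{ty}}[(\mathit{off}_i:\mathtt{ty}_i:v_i..\hat v_i)]_{i=1}^n\in\mathit{LI}$ with recursive field $j$: $v_\ell\ge1\wedge v_{\mathit{ad}}\ge1$; $\bigwedge_{i=1}^n v_i=\hat v_i$ if $\models\langle s\rangle\Rightarrow v_\ell=1$; $v_j\ge1$ if $\models\langle s\rangle\Rightarrow v_\ell\ge2$; $v_\ell\ge2$ if there is $1\le k\le n$ with $\models\langle s\rangle\Rightarrow v_k\ne\hat v_k$. Concrete states. A state $c$ is concrete iff $c=\mathit{ERR}$ or $c=(p,\mathit{LV},\mathit{AL},\mathit{PT},\emptyset,\mathit{KB})$ where $\langle c\rangle$ is satisfiable; for every $v\in\mathcal V_{\mathit{sym}}(c)$ there is $n\in\mathbb N$ with $\models\langle c\rangle\Rightarrow v=n$; all entries of $\mathit{PT}$ have type $\mathtt{i8}$; for every $[\![v_1,v_2]\!]\in\mathit{AL}$ and every $n$ with $\models\langle c\rangle\Rightarrow v_1\le n\le v_2$ there is $(w_1\hookrightarrow_{\mathtt{i8}}w_2)\in\mathit{PT}$ with $\models\langle c\rangle\Rightarrow w_1=n$ and $\models\langle c\rangle\Rightarrow w_2=m$ for some $m\in[0,2^8-1]$; and every $(w_1\hookrightarrow_{\mathtt{i8}}w_2)\in\mathit{PT}$ satisfies $\models\langle c\rangle\Rightarrow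 v_1\le w_1\le v_2$ for some $[\![v_1,v_2]\!]\in\mathit{AL}$. For a concrete $c\ne\mathit{ERR}$: $\mathit{as}^c(\mathtt{x})=n$ where $\models\langle c\rangle\Rightarrow\mathit{LV}(\mathtt x)=n$ (for $\mathtt x\in\mathrm{dom}(\mathit{LV})$), and $\mathit{mem}^c:\mathbb N_{>0}\rightharpoonup[0,2^8-1]$ is defined at $n$ iff some $(w_1\hookrightarrow_{\mathtt{i8}}w_2)\in\mathit{PT}$ has $\models\langle c\rangle\Rightarrow w_1=n$, and then $\mathit{mem}^c(n)=m$ where $\models\langle c\rangle\Rightarrow w_2=m$. Separation logic. For $\mathit{as}:\mathcal V_{\mathcal P}\to\mathbb N$ and $\mathit{mem}:\mathbb N_{>0}\rightharpoonup[0,2^8-1]$, $(\mathit{as},\mathit{mem})\models\varphi$ iff $\mathit{mem}\models\mathit{as}(\varphi)$ (program variables replaced by their values); free symbolic variables are implicitly universally quantified over $\mathbb N$; arithmetic and first-order connectives are as usual. $\mathit{mem}\models n_1\hookrightarrow n_2$ iff $\mathit{mem}(n_1)=n_2$; $\mathit{mem}\models n_1\hookrightarrow_0 n_2$ always; $\mathit{mem}\models n_1\hookrightarrow_{n+1}n_2$ iff $\mathit{mem}\models n_1\hookrightarrow(n_2\bmod 2^8)$ and $\mathit{mem}\models (n_1+1)\hookrightarrow_n(n_2\operatorname{div}2^8)$. $\mathit{mem}\models\varphi_1*\varphi_2$ iff $\mathit{mem}=\mathit{mem}_1\uplus\mathit{mem}_2$ with disjoint domains, $\mathit{mem}_1\models\varphi_1$,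 $\mathit{mem}_2\models\varphi_2$; the empty separating conjunction is $\mathit{true}$. List predicate: for $\mathit{bs},\ell,n_{\mathit{ad}},s_i\in\mathbb N_{>0}$, $\mathit{off}_i,m_i,\hat m_i\in\mathbb N$, $1\le j\le n$: $\mathit{mem}\models\mathit{li}_{\mathit{bs},j}(1,n_{\mathit{ad}},[(\mathit{off}_i:s_i:m_i..\hat m_i)]_{i=1}^n)$ iff $\mathit{mem}\models\forall x\exists y.\,(n_{\mathit{ad}}\le x\le n_{\mathit{ad}}+\mathit{bs}-1)\Rightarrow x\hookrightarrow y$ and for all $i$: $m_i=\hat m_i$ and $\mathit{mem}\models n_{\mathit{ad}}+\mathit{off}_i\hookrightarrow_{s_i}m_i$; for $\ell>1$, $\mathit{mem}\models\mathit{li}_{\mathit{bs},j}(\ell,n_{\mathit{ad}},[(\mathit{off}_i:s_i:m_i..\hat m_i)]_{i=1}^n)$ iff $\mathit{mem}\models(\forall x\exists y.\,(n_{\mathit{ad}}\le x\le n_{\mathit{ad}}+\mathit{bs}-1)\Rightarrow x\hookrightarrow y)*\mathit{li}_{\mathit{bs},j}(\ell-1,m_j,[(\mathit{off}_i:s_i:\overline{m_i}..\hat m_i)]_{i=1}^n)$ for some $\overline{m_i}\in\mathbb N$, and $\mathit{mem}\models n_{\mathit{ad}}+\mathit{off}_i\hookrightarrow_{s_i}m_i$ for all $i$. Define $\langle[\![v_1,v_2]\!]\rangle_{\mathit{SL}}=\forall x\exists y.\,(v_1\le x\le v_2)\Rightarrow x\hookrightarrow y$, $\langle v_1\hookrightarrow_{\mathtt{ty}}v_2\rangle_{\mathit{SL}}=v_1\hookrightarrow_{\mathit{size}(\mathtt{ty})}v_2$,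 $\langle v_{\mathit{ad}}\hookrightarrow^{v_\ell}_{\mathtt{ty}}[(\mathit{off}_i:\mathtt{ty}_i:v_i..\hat v_i)]_{i=1}^n\rangle_{\mathit{SL}}=\mathit{li}_{\mathit{size}(\mathtt{ty}),j}(v_\ell,v_{\mathit{ad}},[(\mathit{off}_i:\mathit{size}(\mathtt{ty}_i):v_i..\hat v_i)]_{i=1}^n)$ ($j$ the recursive field), and $\langle s\rangle_{\mathit{SL}}=\langle s\rangle\wedge\mathit{LV}\wedge\big(((\ast_{\varphi\in\mathit{AL}}\langle\varphi\rangle_{\mathit{SL}})\wedge(\bigwedge_{\varphi\in\mathit{PT}}\langle\varphi\rangle_{\mathit{SL}}))\ast(\ast_{\varphi\in\mathit{LI}}\langle\varphi\rangle_{\mathit{SL}})\big)$. Representation. A concrete state $c=(p,\mathit{LV}^c,\mathit{AL}^c,\mathit{PT}^c,\emptyset,\mathit{KB}^c)$ is represented by $s=(p,\mathit{LV}^s,\mathit{AL}^s,\mathit{PT}^s,\mathit{LI}^s,\mathit{KB}^s)$ (same position) iff $\mathrm{dom}(\mathit{LV}^c)=\mathrm{dom}(\mathit{LV}^s)$ and there is $\sigma:\mathcal V_{\mathit{sym}}\to\mathbb N$ such that: $(\mathit{as}^c,\mathit{mem}^c)\models\sigma(\langle s\rangle_{\mathit{SL}})$; for every $[\![v_1,v_2]\!]\in\mathit{AL}^s$ there is $[\![w_1,w_2]\!]\in\mathit{AL}^c$ with $\models\langle c\rangle\Rightarrow w_1=\sigma(v_1)\wedge w_2=\sigma(v_2)$;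 and for every $v_{\mathit{ad}}\hookrightarrow^{v_\ell}_{\mathtt{ty}}[(\mathit{off}_i:\mathtt{ty}_i:v_i..\hat v_i)]_{i=1}^n\in\mathit{LI}^s$ with recursive field $j$ there are $[\![w^{\mathit{start}}_k,w^{\mathit{end}}_k]\!]\in\mathit{AL}^c$ for $1\le k\le\sigma(v_\ell)$ such that, with $m^{\mathit{start}}_k,m^{\mathit{end}}_k$ the numbers with $\models\langle c\rangle\Rightarrow w^{\mathit{start}}_k=m^{\mathit{start}}_k$ and $\models\langle c\rangle\Rightarrow w^{\mathit{end}}_k=m^{\mathit{end}}_k$, $(\mathit{as}^c,\mathit{mem}^c)\models\bigwedge_{k=1}^{\sigma(v_\ell)}(m^{\mathit{end}}_k-m^{\mathit{start}}_k=\mathit{size}(\mathtt{ty})-1)\wedge\sigma(v_{\mathit{ad}})=m^{\mathit{start}}_1\wedge\bigwedge_{k=1}^{\sigma(v_\ell)-1}m^{\mathit{start}}_k+\mathit{off}_j\hookrightarrow_{\mathit{size}(\mathtt{ty*})}m^{\mathit{start}}_{k+1}$. $\mathit{ERR}$ is represented only by $\mathit{ERR}$. List traversal rule (instruction $\mathtt{pb = getelementptr\ i8,\ i8*\ pa,\ i}m\ t$ at $p$). From $s=(p,\mathit{LV},\mathit{AL},\mathit{PT},\mathit{LI},\mathit{KB})$ it yields $s'=(p^+,\mathit{LV}[\mathtt{pb}:=w^{\mathit{start}}_j],\mathit{AL}\cup\{[\![v^{\mathit{start}},v^{\mathit{end}}]\!]\},\mathit{PT}',(\mathit{LI}\setminus\{l\})\cup\{l'\},\mathit{KB}')$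 provided: there is $l=(v_{\mathit{ad}}\hookrightarrow^{v_\ell}_{\mathtt{ty}}[(\mathit{off}_i:\mathtt{ty}_i:v_i..\hat v_i)]_{i=1}^n)\in\mathit{LI}$ with $\mathtt{ty}_j=\mathtt{ty*}$, $\models\langle s\rangle\Rightarrow\mathit{LV}(\mathtt{pa})=v_j$, $\models\langle s\rangle\Rightarrow\mathit{LV}(t)=\mathit{off}_j$, and $\models\langle s\rangle\Rightarrow v_\ell\ge2$; $\mathit{PT}'=\mathit{PT}\cup\{(v^{\mathit{start}}_i\hookrightarrow_{\mathtt{ty}_i}v_i)\mid1\le i\le n\}$; $l'=(w^{\mathit{start}}\hookrightarrow^{w_\ell}_{\mathtt{ty}}[(\mathit{off}_i:\mathtt{ty}_i:w_i..\hat v_i)]_{i=1}^n)$; $\mathit{KB}'=\mathit{KB}\cup\{v^{\mathit{start}}=v_{\mathit{ad}},\ v^{\mathit{end}}=v^{\mathit{start}}+\mathit{size}(\mathtt{ty})-1,\ w^{\mathit{start}}=v_j,\ w_\ell=v_\ell-1,\ w^{\mathit{start}}_j=w^{\mathit{start}}+\mathit{off}_j\}\cup\{v^{\mathit{start}}_i=v_{\mathit{ad}}+\mathit{off}_i\mid1\le i\le n\}$; and $v^{\mathit{start}},v^{\mathit{end}},v^{\mathit{start}}_1,\dots,v^{\mathit{start}}_n,w^{\mathit{start}},w_\ell,w^{\mathit{start}}_j,w_1,\dots,w_n\in\mathcal V_{\mathit{sym}}$ are fresh. Concrete getelementptr rule (same instruction). From $s=(p,\mathit{LV},\mathit{AL},\mathit{PT},\emptyset,\mathit{KB})$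 it yields $s'=(p^+,\mathit{LV}[\mathtt{pb}:=w],\mathit{AL},\mathit{PT},\emptyset,\mathit{KB}\cup\{w=\mathit{LV}(\mathtt{pa})+\mathit{LV}(t)\})$ with $w\in\mathcal V_{\mathit{sym}}$ fresh.
   Formalization: Added, as the claim fails without them: list fields satisfy off_i+size(ty_i) ≤ size(ty); under σ, points-to entries (and fields of one list invariant) of equal type and address (offset) hold equal values; all addresses in mem^c are below 2^(8·size(ty* )) for every ty. *)

(* Defs.v *)
From Stdlib Require Import ZArith List Ensembles FinFun ClassicalEpsilon Lia.
Import ListNotations.

Set Implicit Arguments.
Unset Strict Implicit.
Unset Printing Implicit Defensive.

Record llvm_types := LlvmTypes {
  ty :> Type;
  size : ty -> nat;
  size_pos : forall a, 0 < size a;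
  ptr : ty -> ty;
  i8 : ty;
  size_i8 : size i8 = 1
}.
Arguments i8 {_}.

Section Arithmetic.
Context {Vsym : Type}.

Inductive aexp :=
| AVar (v : Vsym)
| AConst (z : Z)
| AAdd (a b : aexp)
| ASub (a b : aexp)
| AMul (a b : aexp).

Inductive form :=
| FTrue
| FEq (a b : aexp)
| FLe (a b : aexp)
| FLt (a b : aexp)
| FNot (f : form)
| FAnd (f g : form)
| FOr (f g : form)
| FImp (f g : form).

Fixpoint aeval (r : Vsym -> Z) (a : aexp) : Z :=
  match a with
  | AVar v => r v
  | AConst z => z
  | AAdd a b => aeval r a + aeval r b
  | ASub a b => aeval r a - aeval r b
  | AMul a b => aeval r a * aeval r b
  end%Z.

Fixpoint holds (r : Vsym -> Z) (f : form) : Prop :=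
  match f with
  | FTrue => True
  | FEq a b => aeval r a = aeval r b
  | FLe a b => (aeval r a <= aeval r b)%Z
  | FLt a b => (aeval r a < aeval r b)%Z
  | FNot f => ~ holds r f
  | FAnd f g => holds r f /\ holds r g
  | FOr f g => holds r f \/ holds r g
  | FImp f g => holds r f -> holds r g
  end.

Fixpoint avar_in (v : Vsym) (a : aexp) : Prop :=
  match a with
  | AVar w => v = w
  | AConst _ => False
  | AAdd a b | ASub a b | AMul a b => avar_in v a \/ avar_in v b
  end.

Fixpoint fvar_in (v : Vsym) (f : form) : Prop :=
  match f with
  | FTrue => False
  | FEq a b | FLe a b | FLt a b => avar_in v a \/ avar_in v b
  | FNot f => fvar_in v f
  | FAnd f g | FOr f g | FImp f g => fvar_in v f \/ fvar_in v g
  end.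

Definition FNe (a b : aexp) : form := FNot (FEq a b).
Definition FConj (fs : list form) : form := fold_right FAnd FTrue fs.

Definition satisfiable (F : Ensemble form) : Prop :=
  exists r, forall f, F f -> holds r f.

Definition entails (F : Ensemble form) (f : form) : Prop :=
  forall r, (forall g, F g -> holds r g) -> holds r f.

End Arithmetic.
Arguments aexp : clear implicits.
Arguments form : clear implicits.

Definition anat {Vsym : Type} (n : nat) : aexp Vsym := AConst (Z.of_nat n).

Section States.
Context {Vp Vsym Blk : Type} {T : llvm_types}.

Definition position : Type := Blk * nat.
Definition next (p : position) : position := (fst p, S (snd p)).

Inductive operand := OVar (x : Vp) | ONat (n : nat).

(* [GetElementPtr pb pa m t] is  pb = getelementptr i8, i8* pa, im t. *)
Inductive instruction :=
| GetElementPtr (pb pa : Vp) (m : nat) (t : operand)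
| OtherInstruction.

Definition program : Type := position -> option instruction.

Record pt_entry := PtEntry { pt_addr : Vsym; pt_ty : T; pt_val : Vsym }.

(* The field  off_i : ty_i : v_i .. v^_i  of a list invariant; [fld_first] is
   the value v_i in the first list element, [fld_last] the value v^_i in the
   last one. *)
Record field := Field {
  fld_off : nat; fld_ty : T; fld_first : Vsym; fld_last : Vsym
}.

(* [li_rec] is the recursive field (0-based); [li_wf] below makes it a function
   of the other components. *)
Record list_inv := ListInv {
  li_ad : Vsym; li_len : Vsym; li_ty : T; li_fields : list field; li_rec : nat
}.

Definition li_wf (l : list_inv) : Prop :=
  (exists f, nth_error (li_fields l) (li_rec l) = Some f /\
             fld_ty f = ptr (li_ty l)) /\
  (forall k f, nth_error (li_fields l) k = Some f ->
               fld_ty f = ptr (li_ty l) -> k = li_rec l).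

(* The tuples (p, LV, AL, PT, LI, KB). *)
Record conf := Conf {
  pos : position;
  LV : Vp -> option Vsym;
  AL : Ensemble (Vsym * Vsym);
  PT : Ensemble pt_entry;
  LI : Ensemble list_inv;
  KB : Ensemble (form Vsym)
}.

Definition conf_wf (s : conf) : Prop :=
  (forall x y v, LV s x = Some v -> LV s y = Some v -> x = y) /\
  (forall l, LI s l -> li_wf l).

Inductive state := ERR | Proper (s : conf).

Definition LV_operand (s : conf) (t : operand) : option (aexp Vsym) :=
  match t with
  | OVar x => option_map AVar (LV s x)
  | ONat n => Some (anat n)
  end.

Definition update (f : Vp -> option Vsym) (x : Vp) (w : Vsym)
  : Vp -> option Vsym :=
  fun y => if excluded_middle_informative (y = x) then Some w else f y.

Definition occurs (s : conf) (v : Vsym) : Prop :=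
  (exists x, LV s x = Some v) \/
  (exists a, AL s a /\ (v = fst a \/ v = snd a)) \/
  (exists e, PT s e /\ (v = pt_addr e \/ v = pt_val e)) \/
  (exists l, LI s l /\
     (v = li_ad l \/ v = li_len l \/
      exists f, List.In f (li_fields l) /\ (v = fld_first f \/ v = fld_last f)))
  \/
  (exists f, KB s f /\ fvar_in v f).

Definition fresh (s : conf) (v : Vsym) : Prop := ~ occurs s v.

(* The closure conditions in the definition of <s>; "|= <s> => phi" is read as
   entailment from the set being defined. *)
Record closed (s : conf) (F : Ensemble (form Vsym)) : Prop := Closed {
  closed_KB : forall f, KB s f -> F f;
  closed_AL : forall v1 v2, AL s (v1, v2) ->
    F (FAnd (FLe (anat 1) (AVar v1)) (FLe (AVar v1) (AVar v2)));
  closed_AL_disj : forall v1 v2 w1 w2,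
    AL s (v1, v2) -> AL s (w1, w2) -> (v1, v2) <> (w1, w2) ->
    F (FOr (FLt (AVar v2) (AVar w1)) (FLt (AVar w2) (AVar v1)));
  closed_PT : forall v1 a v2, PT s (PtEntry v1 a v2) ->
    F (FLe (anat 1) (AVar v1));
  closed_PT_eq : forall a v1 v2 w1 w2,
    PT s (PtEntry v1 a v2) -> PT s (PtEntry w1 a w2) ->
    entails F (FEq (AVar v1) (AVar w1)) -> F (FEq (AVar v2) (AVar w2));
  closed_PT_ne : forall a v1 v2 w1 w2,
    PT s (PtEntry v1 a v2) -> PT s (PtEntry w1 a w2) ->
    entails F (FNe (AVar v2) (AVar w2)) -> F (FNe (AVar v1) (AVar w1));
  closed_LI : forall l, LI s l ->
    F (FAnd (FLe (anat 1) (AVar (li_len l))) (FLe (anat 1) (AVar (li_ad l))));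
  closed_LI_one : forall l, LI s l ->
    entails F (FEq (AVar (li_len l)) (anat 1)) ->
    F (FConj (map (fun f => FEq (AVar (fld_first f)) (AVar (fld_last f)))
                  (li_fields l)));
  closed_LI_rec : forall l f, LI s l ->
    nth_error (li_fields l) (li_rec l) = Some f ->
    entails F (FLe (anat 2) (AVar (li_len l))) ->
    F (FLe (anat 1) (AVar (fld_first f)));
  closed_LI_two : forall l f, LI s l -> List.In f (li_fields l) ->
    entails F (FNe (AVar (fld_first f)) (AVar (fld_last f))) ->
    F (FLe (anat 2) (AVar (li_len l)))
}.

Definition state_formula (s : conf) : Ensemble (form Vsym) :=
  fun f => forall F, closed s F -> F f.

Lemma entails_mono (F G : Ensemble (form Vsym)) f :
  (forall g, F g -> G g) -> entails F f -> entails G f.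
Proof. intros FG Ff r Hr; apply Ff; auto. Qed.

Lemma state_formula_closed (s : conf) : closed s (state_formula s).
Proof.
split; intros; intros F HF;
  pose proof (fun g (Hg : state_formula s g) => Hg F HF) as sub.
- now apply (closed_KB HF).
- now apply (closed_AL HF).
- now apply (closed_AL_disj HF).
- now apply (closed_PT HF) in H.
- apply (closed_PT_eq HF H H0); eapply entails_mono; eauto.
- apply (closed_PT_ne HF H H0); eapply entails_mono; eauto.
- now apply (closed_LI HF).
- apply (closed_LI_one HF H); eapply entails_mono; eauto.
- apply (closed_LI_rec HF H H0); eapply entails_mono; eauto.
- apply (closed_LI_two HF H H0); eapply entails_mono; eauto.
Qed.

(* |= <c> => v = n *)
Definition has_value (c : conf) (v : Vsym) (n : nat) : Prop :=
  entails (state_formula c) (FEq (AVar v) (anat n)).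

Definition concrete_conf (c : conf) : Prop :=
  conf_wf c /\
  LI c = Empty_set _ /\
  satisfiable (state_formula c) /\
  (forall v, occurs c v -> exists n, has_value c v n) /\
  (forall e, PT c e -> pt_ty e = i8) /\
  (forall v1 v2 n, AL c (v1, v2) ->
     entails (state_formula c)
       (FAnd (FLe (AVar v1) (anat n)) (FLe (anat n) (AVar v2))) ->
     exists w1 w2 m, PT c (PtEntry w1 i8 w2) /\
       has_value c w1 n /\ has_value c w2 m /\ m < 2 ^ 8) /\
  (forall w1 w2, PT c (PtEntry w1 i8 w2) ->
     exists v1 v2, AL c (v1, v2) /\
       entails (state_formula c)
         (FAnd (FLe (AVar v1) (AVar w1)) (FLe (AVar w1) (AVar v2)))).

Definition concrete (c : state) : Prop :=
  match c with ERR => True | Proper c => concrete_conf c end.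

Definition the_nat (P : nat -> Prop) : option nat :=
  if excluded_middle_informative (exists n, P n)
  then Some (epsilon (inhabits 0) P) else None.

Definition stack : Type := Vp -> option nat.

(* Memories are arbitrary partial functions on nat; that those arising from
   concrete states map N_{>0} to bytes is [mem_of_range]. *)
Definition memory : Type := nat -> option nat.

Definition as_of (c : conf) : stack := fun x =>
  the_nat (fun n => exists v, LV c x = Some v /\ has_value c v n).

Definition mem_of (c : conf) : memory := fun n =>
  the_nat (fun m => exists w1 w2,
    PT c (PtEntry w1 i8 w2) /\ has_value c w1 n /\ has_value c w2 m).

(* Assertions after instantiation of the symbolic variables. Program variables
   occur only in the equations LV, which [state_SL] treats separately. *)
Definition assertion : Type := memory -> Prop.

Definition munion (mem mem1 mem2 : memory) : Prop :=
  (forall n, mem1 n = None \/ mem2 n = None) /\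
  (forall n b, mem n = Some b <-> mem1 n = Some b \/ mem2 n = Some b).

Definition star (P Q : assertion) : assertion := fun mem =>
  exists mem1 mem2, munion mem mem1 mem2 /\ P mem1 /\ Q mem2.

(* Iterated separating conjunction of P i over i in A; see [bigstar_empty],
   [bigstar_singleton] and [bigstar_add] for its relation to [star]. *)
Definition bigstar {I : Type} (A : Ensemble I) (P : I -> assertion)
  : assertion := fun mem =>
  (exists i, A i) ->
  exists mems : I -> memory,
    (forall i k n, A i -> A k -> i <> k ->
       mems i n = None \/ mems k n = None) /\
    (forall n b, mem n = Some b <-> exists i, A i /\ mems i n = Some b) /\
    (forall i, A i -> P i (mems i)).

Fixpoint points_to (k n1 n2 : nat) : assertion := fun mem =>
  match k with
  | 0 => True
  | S k => mem n1 = Some (n2 mod 2 ^ 8) /\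
           points_to k (n1 + 1) (n2 / 2 ^ 8) mem
  end.

Definition block (n1 n2 : nat) : assertion := fun mem =>
  forall x, exists y, n1 <= x <= n2 -> mem x = Some y.

(* An instantiated list field  off_i : s_i : m_i .. m^_i. *)
Record cell := Cell {
  cell_off : nat; cell_size : nat; cell_first : nat; cell_last : nat
}.

Definition set_first (f : cell) (m : nat) : cell :=
  Cell (cell_off f) (cell_size f) m (cell_last f).

Definition cells_at (n_ad : nat) (fs : list cell) : assertion := fun mem =>
  Forall (fun f => points_to (cell_size f) (n_ad + cell_off f)
                             (cell_first f) mem) fs.

Fixpoint li (bs j len n_ad : nat) (fs : list cell) : assertion := fun mem =>
  match len with
  | 0 => False
  | S len' =>
    match len' with
    | 0 =>
      block n_ad (n_ad + bs - 1) mem /\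
      Forall (fun f => cell_first f = cell_last f) fs /\
      cells_at n_ad fs mem
    | S _ =>
      (exists fj ms,
         nth_error fs j = Some fj /\ length ms = length fs /\
         star (block n_ad (n_ad + bs - 1))
              (li bs j len' (cell_first fj)
                  (map (fun fm => set_first (fst fm) (snd fm))
                       (combine fs ms))) mem) /\
      cells_at n_ad fs mem
    end
  end.

Definition alloc_SL (sg : Vsym -> nat) (a : Vsym * Vsym) : assertion :=
  block (sg (fst a)) (sg (snd a)).

Definition pt_SL (sg : Vsym -> nat) (e : pt_entry) : assertion :=
  points_to (size (pt_ty e)) (sg (pt_addr e)) (sg (pt_val e)).

Definition li_SL (sg : Vsym -> nat) (l : list_inv) : assertion :=
  li (size (li_ty l)) (li_rec l) (sg (li_len l)) (sg (li_ad l))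
     (map (fun f => Cell (fld_off f) (size (fld_ty f))
                         (sg (fld_first f)) (sg (fld_last f)))
          (li_fields l)).

(* (as, mem) |= sg(<s>_SL) *)
Definition state_SL (s : conf) (sg : Vsym -> nat) (as_ : stack) (mem : memory)
  : Prop :=
  (forall f, state_formula s f -> holds (fun v => Z.of_nat (sg v)) f) /\
  (forall x v, LV s x = Some v -> as_ x = Some (sg v)) /\
  star (fun mem1 => bigstar (AL s) (alloc_SL sg) mem1 /\
                    forall e, PT s e -> pt_SL sg e mem1)
       (bigstar (LI s) (li_SL sg)) mem.

Definition li_allocated (sg : Vsym -> nat) (c : conf) (l : list_inv) : Prop :=
  forall fj, nth_error (li_fields l) (li_rec l) = Some fj ->
  exists (ws we : nat -> Vsym) (ms me : nat -> nat),
    (forall k, 1 <= k <= sg (li_len l) ->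
       AL c (ws k, we k) /\ has_value c (ws k) (ms k) /\
       has_value c (we k) (me k) /\
       (Z.of_nat (me k) - Z.of_nat (ms k) = Z.of_nat (size (li_ty l)) - 1)%Z) /\
    sg (li_ad l) = ms 1 /\
    (forall k, 1 <= k <= sg (li_len l) - 1 ->
       points_to (size (ptr (li_ty l))) (ms k + fld_off fj) (ms (k + 1))
                 (mem_of c)).

Definition represented_via (sg : Vsym -> nat) (c s : conf) : Prop :=
  concrete_conf c /\ conf_wf s /\
  pos c = pos s /\
  (forall x, LV c x = None <-> LV s x = None) /\
  state_SL s sg (as_of c) (mem_of c) /\
  (forall v1 v2, AL s (v1, v2) -> exists w1 w2,
     AL c (w1, w2) /\ has_value c w1 (sg v1) /\ has_value c w2 (sg v2)) /\
  (forall l, LI s l -> li_allocated sg c l).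

Definition represented (c s : state) : Prop :=
  match c, s with
  | ERR, ERR => True
  | Proper c, Proper s => exists sg, represented_via sg c s
  | _, _ => False
  end.

Definition list_traversal (pb pa : Vp) (t : operand) (s s' : conf) : Prop :=
  exists (l : list_inv) (fj : field) (a : Vsym) (tt : aexp Vsym)
         (vstart vend wstart wlen wstartj : Vsym) (vstarts ws : list Vsym),
    LI s l /\
    nth_error (li_fields l) (li_rec l) = Some fj /\
    LV s pa = Some a /\
    entails (state_formula s) (FEq (AVar a) (AVar (fld_first fj))) /\
    LV_operand s t = Some tt /\
    entails (state_formula s) (FEq tt (anat (fld_off fj))) /\
    entails (state_formula s) (FLe (anat 2) (AVar (li_len l))) /\
    length vstarts = length (li_fields l) /\
    length ws = length (li_fields l) /\
    (let new := [vstart; vend; wstart; wlen; wstartj] ++ vstarts ++ ws in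
     NoDup new /\ Forall (fresh s) new) /\
    let l' := ListInv wstart wlen (li_ty l)
                (map (fun fw => let (f, w) := fw : field * Vsym in
                        Field (fld_off f) (fld_ty f) w (fld_last f))
                     (combine (li_fields l) ws))
                (li_rec l) in
    s' = Conf
      (next (pos s))
      (update (LV s) pb wstartj)
      (Add _ (AL s) (vstart, vend))
      (Union _ (PT s) (fun e => List.In e
         (map (fun fv => let (f, v) := fv : field * Vsym in
                 PtEntry v (fld_ty f) (fld_first f))
              (combine (li_fields l) vstarts))))
      (Add _ (Subtract _ (LI s) l) l')
      (Union _ (KB s) (fun f => List.In f
         ([FEq (AVar vstart) (AVar (li_ad l));
           FEq (AVar vend)
               (ASub (AAdd (AVar vstart) (anat (size (li_ty l)))) (anat 1));
           FEq (AVar wstart) (AVar (fld_first fj));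
           FEq (AVar wlen) (ASub (AVar (li_len l)) (anat 1));
           FEq (AVar wstartj) (AAdd (AVar wstart) (anat (fld_off fj)))] ++
          map (fun fv => let (f, v) := fv : field * Vsym in
                 FEq (AVar v) (AAdd (AVar (li_ad l)) (anat (fld_off f))))
              (combine (li_fields l) vstarts)))).

Definition concrete_gep (pb pa : Vp) (t : operand) (s s' : conf) : Prop :=
  exists (a : Vsym) (tt : aexp Vsym) (w : Vsym),
    LI s = Empty_set _ /\
    LV s pa = Some a /\
    LV_operand s t = Some tt /\
    fresh s w /\
    s' = Conf (next (pos s)) (update (LV s) pb w) (AL s) (PT s) (Empty_set _)
              (Add _ (KB s) (FEq (AVar w) (AAdd (AVar a) tt))).

(* off_i : ty_i is a field of the element type ty, so it lies inside ty. *)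
Definition fields_inside (s : conf) : Prop :=
  forall l f, LI s l -> List.In f (li_fields l) ->
    fld_off f + size (fld_ty f) <= size (li_ty l).

(* [points_to k n1 n2] only fixes n2 modulo 2 ^ (8 * k). The next two conditions
   exclude that this truncation identifies different numbers: entries with the
   same type and address store the same number, and every address of the memory
   fits into a pointer. *)
Definition values_agree (sg : Vsym -> nat) (s : conf) : Prop :=
  (forall a v1 v2 w1 w2,
     PT s (PtEntry v1 a v2) -> PT s (PtEntry w1 a w2) ->
     sg v1 = sg w1 -> sg v2 = sg w2) /\
  (forall l f g, LI s l ->
     List.In f (li_fields l) -> List.In g (li_fields l) ->
     fld_ty f = fld_ty g -> fld_off f = fld_off g ->
     sg (fld_first f) = sg (fld_first g)).

Definition addresses_fit (c : conf) : Prop :=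
  forall (a : T) n, mem_of c n <> None -> n < 2 ^ (8 * size (ptr a)).

Lemma mem_of_range (c : conf) n m :
  concrete_conf c -> mem_of c n = Some m -> 0 < n /\ m < 2 ^ 8.
Proof.
intros (_ & _ & [r Hr] & _ & _ & HAL & HPT) Hm.
unfold mem_of, the_nat in Hm.
destruct excluded_middle_informative as [Hex|]; [|discriminate].
injection Hm as Hm.
pose proof (epsilon_spec (inhabits 0) _ Hex) as (w1 & w2 & He & H1 & H2).
rewrite Hm in H2.
pose proof (state_formula_closed c) as Hc.
split.
- pose proof (Hr _ (closed_PT Hc He)) as Hp; pose proof (H1 r Hr) as Hn.
  simpl in *; lia.
- destruct (HPT _ _ He) as (v1 & v2 & Hal & Hin).
  destruct (HAL v1 v2 n Hal) as (u1 & u2 & m' & Hu & Hu1 & Hu2 & Hlt).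
  + intros q Hq; pose proof (Hin q Hq); pose proof (H1 q Hq).
    simpl in *; lia.
  + assert (E : state_formula c (FEq (AVar w2) (AVar u2))).
    { apply (closed_PT_eq Hc He Hu); intros q Hq.
      pose proof (H1 q Hq); pose proof (Hu1 q Hq); simpl in *; lia. }
    pose proof (Hr _ E); pose proof (H2 r Hr); pose proof (Hu2 r Hr).
    simpl in *; lia.
Qed.

Lemma bigstar_empty I (P : I -> assertion) mem : bigstar (Empty_set I) P mem.
Proof. intros [i []]. Qed.

Lemma munion_ext (m m1 m2 : memory) (H : munion m m1 m2) n :
  m n = match m1 n with Some b => Some b | None => m2 n end.
Proof.
destruct H as [_ H]; specialize (H n).
destruct (m1 n) as [b|] eqn:E1; [now apply H; left|].
destruct (m2 n) as [b|] eqn:E2; [now apply H; right|].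
destruct (m n) as [b|] eqn:E; [|reflexivity].
destruct (proj1 (H b) eq_refl); discriminate.
Qed.

Lemma bigstar_singleton I (P : I -> assertion) i mem :
  (forall m m' : memory, (forall n, m n = m' n) -> P i m -> P i m') ->
  bigstar (Singleton I i) P mem <-> P i mem.
Proof.
intros Pext; split.
- intros H; destruct H as (mems & _ & Hu & HP); [now exists i|].
  apply (Pext (mems i)); [|now apply HP].
  intros n; destruct (mems i n) as [b|] eqn:E.
  + symmetry; apply Hu; now exists i.
  + destruct (mem n) as [b|] eqn:E'; [|reflexivity].
    apply Hu in E' as (k & [] & Hk); congruence.
- intros H _; exists (fun _ => mem); split; [|split].
  + intros j k n [] []; tauto.
  + intros n b; split; [now exists i|now intros (k & _ & ?)].
  + now intros k [].
Qed.

Lemma bigstar_add I (A : Ensemble I) (P : I -> assertion) a mem :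
  (exists i, A i) -> ~ A a ->
  bigstar (Add I A a) P mem <-> star (P a) (bigstar A P) mem.
Proof.
intros [i0 Hi0] Ha; split.
- intros H; destruct H as (mems & Hd & Hu & HP).
  { exists a; right; constructor. }
  exists (mems a), (fun n => match mems a n with
                             | Some _ => None | None => mem n end).
  assert (Aa : Add I A a a) by (right; constructor).
  split; [split|split].
  + intros n; destruct (mems a n); auto.
  + intros n b; destruct (mems a n) as [b'|] eqn:E; split.
    * intros Hb; left.
      rewrite <- Hb; symmetry; apply Hu; now exists a.
    * intros [Hb|]; [|discriminate]; apply Hu; exists a; split; congruence.
    * now right.
    * now intros [|].
  + now apply HP.
  + intros _; exists mems; split; [|split].
    * intros i k n Hi Hk; apply Hd; now left.
    * intros n b; destruct (mems a n) as [b'|] eqn:E; split.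
      -- discriminate.
      -- intros (i & Hi & Hb).
         destruct (Hd a i n Aa (Union_introl _ _ _ _ Hi)); try congruence.
      -- intros Hb; apply Hu in Hb as (i & [i' Hi|i' []] & Hb);
           [now exists i'|congruence].
      -- intros (i & Hi & Hb); apply Hu; exists i; split; [now left|easy].
    * intros i Hi; apply HP; now left.
- intros (m1 & m2 & [Hd Hu] & HPa & HA) _.
  destruct HA as (mems & Hd' & Hu' & HP); [now exists i0|].
  exists (fun i => if excluded_middle_informative (i = a) then m1 else mems i).
  assert (Hsub : forall i n, A i -> m2 n = None -> mems i n = None).
  { intros i n Hi Hn; destruct (mems i n) eqn:E; [|reflexivity].
    rewrite <- Hn; symmetry; apply Hu'; now exists i. }
  split; [|split].
  + intros i k n Hi Hk Hne.
    destruct (excluded_middle_informative (i = a)) as [->|Hia];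
    destruct (excluded_middle_informative (k = a)) as [->|Hka].
    * tauto.
    * destruct Hk as [k Hk|k []]; [|tauto].
      destruct (Hd n); [now left|right; auto].
    * destruct Hi as [i Hi|i []]; [|tauto].
      destruct (Hd n); [now right|left; auto].
    * destruct Hk as [k Hk|k []]; [|tauto].
      destruct Hi as [i Hi|i []]; [|tauto]. now apply Hd'.
  + intros n b; rewrite Hu; split.
    * intros [Hb|Hb].
      -- exists a; split; [right; constructor|].
         now destruct excluded_middle_informative.
      -- apply Hu' in Hb as (i & Hi & Hb); exists i; split; [now left|].
         destruct excluded_middle_informative as [->|]; tauto.
    * intros (i & Hi & Hb).
      destruct (excluded_middle_informative (i = a)) as [->|Hia]; [now left|].
      destruct Hi as [i Hi|i []]; [|tauto].
      right; apply Hu'; now exists i.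
  + intros i Hi.
    destruct (excluded_middle_informative (i = a)) as [->|Hia]; [easy|].
    destruct Hi as [i Hi|i []]; [|tauto]; now apply HP.
Qed.

End States.

Arguments position : clear implicits.
Arguments operand : clear implicits.
Arguments instruction : clear implicits.
Arguments program : clear implicits.
Arguments conf : clear implicits.
Arguments state : clear implicits.

(* Main.v *)
(* The valuation of s is extended to the fresh variables of s'.  In the memory,
   the block of the first list element moves from the part described by LI to
   the part described by AL and PT, where it is disjoint from all old blocks
   and points-to entries, and the remaining list starts at v_j.

   State formulas are handled by exhibiting closed sets.  For s', the set of all
   formulas true under the extended valuation is closed.  For c', the set of all
   consequences of <c> and the equation defining w is closed, so <c'> is a
   conservative extension of <c>.

   The start of the second allocation is only known to agree with v_j modulo
   the pointer range; both are addresses of the memory, hence they are equal. *)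
Require Import Defs.
From Stdlib Require Import FinFun.
From Stdlib Require Import ZArith List Ensembles Constructive_sets
  ClassicalEpsilon FunctionalExtensionality PropExtensionality Lia.
Import ListNotations.

Set Implicit Arguments.
Unset Strict Implicit.

(** * Evaluation of expressions and formulas under a change of valuation *)

Lemma aeval_ext Vsym (r r' : Vsym -> Z) (a : aexp Vsym) :
  (forall v, avar_in v a -> r v = r' v) -> aeval r a = aeval r' a.
Proof.
induction a; simpl; intros E; auto; now rewrite IHa1, IHa2 by auto.
Qed.

Lemma holds_ext Vsym (r r' : Vsym -> Z) (f : form Vsym) :
  (forall v, fvar_in v f -> r v = r' v) -> holds r f <-> holds r' f.
Proof.
induction f; simpl; intros E;
  try (rewrite (aeval_ext (a := a) (r' := r')), (aeval_ext (a := b) (r' := r'))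
         by auto); try rewrite IHf by auto;
  try rewrite IHf1, IHf2 by auto; tauto.
Qed.

Lemma holds_FConj Vsym (r : Vsym -> Z) (fs : list (form Vsym)) :
  holds r (FConj fs) <-> Forall (holds r) fs.
Proof.
induction fs; simpl; [now split|].
rewrite Forall_cons_iff; tauto.
Qed.

Lemma fvar_in_FConj Vsym (v : Vsym) (fs : list (form Vsym)) :
  fvar_in v (FConj fs) -> exists f, List.In f fs /\ fvar_in v f.
Proof. induction fs; simpl; firstorder (subst; eauto). Qed.

(** * Variables occurring in a state and in its state formula *)

Section States.
Context {Vp Vsym Blk : Type} {T : llvm_types}.
Implicit Types (c s : conf Vp Vsym Blk T) (v w : Vsym).

Lemma occurs_LV s x v : LV s x = Some v -> occurs s v.
Proof. left; now exists x. Qed.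

Lemma occurs_AL s v1 v2 : AL s (v1, v2) -> occurs s v1 /\ occurs s v2.
Proof. split; right; left; exists (v1, v2); auto. Qed.

Lemma occurs_PT s v1 (a : T) v2 :
  PT s (PtEntry v1 a v2) -> occurs s v1 /\ occurs s v2.
Proof. split; right; right; left; exists (PtEntry v1 a v2); auto. Qed.

Lemma occurs_LI s l :
  LI s l -> occurs s (li_ad l) /\ occurs s (li_len l) /\
    forall f, List.In f (li_fields l) ->
      occurs s (fld_first f) /\ occurs s (fld_last f).
Proof.
intros Hl.
repeat split; right; right; right; left; exists l; split; eauto 6.
Qed.

Lemma occurs_KB s f v : KB s f -> fvar_in v f -> occurs s v.
Proof. right; right; right; right; now exists f. Qed.

(** The state formula is the least closed set, and its members over occurring variables already form
    a closed set: whatever this subset entails is entailed by the whole formula, and every closure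
    clause adds only formulas over variables of [s]. *)
Lemma state_formula_occurs s f v :
  state_formula s f -> fvar_in v f -> occurs s v.
Proof.
intros Hf; revert v.
pose (F := fun f => state_formula s f /\ forall v, fvar_in v f -> occurs s v).
enough (HF : closed s F) by now apply (Hf F HF).
assert (up : forall g, entails F g -> entails (state_formula s) g).
{ intros g; apply entails_mono; now intros ? []. }
pose proof (state_formula_closed s) as Hc.
split; intros; (split; [|intros v Hv; simpl in Hv]).
- now apply (closed_KB Hc).
- eapply occurs_KB; eauto.
- now apply (closed_AL Hc).
- apply occurs_AL in H as []; intuition congruence.
- now apply (closed_AL_disj Hc).
- apply occurs_AL in H as []; apply occurs_AL in H0 as [];
    intuition congruence.
- now apply (closed_PT Hc) in H.
- apply occurs_PT in H as []; intuition congruence.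
- apply (closed_PT_eq Hc H H0); auto.
- apply occurs_PT in H as []; apply occurs_PT in H0 as [];
    intuition congruence.
- apply (closed_PT_ne Hc H H0); auto.
- apply occurs_PT in H as []; apply occurs_PT in H0 as [];
    intuition congruence.
- now apply (closed_LI Hc).
- apply occurs_LI in H as (? & ? & _); intuition congruence.
- apply (closed_LI_one Hc H); auto.
- apply fvar_in_FConj in Hv as (g & Hg & Hv).
  apply in_map_iff in Hg as (fd & <- & Hfd); simpl in Hv.
  apply occurs_LI in H as (_ & _ & H); destruct (H _ Hfd).
  intuition congruence.
- apply (closed_LI_rec Hc H H0); auto.
- apply occurs_LI in H as (_ & _ & H); apply nth_error_In in H0.
  destruct (H _ H0); intuition congruence.
- apply (closed_LI_two Hc H H0); auto.
- apply occurs_LI in H as (? & ? & _); intuition congruence.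
Qed.

Lemma models_ext s (r r' : Vsym -> Z) :
  (forall v, occurs s v -> r v = r' v) ->
  (forall f, state_formula s f -> holds r f) ->
  forall f, state_formula s f -> holds r' f.
Proof.
intros E Hr f Hf; apply (holds_ext (r := r)); auto.
intros v Hv; apply E; eapply state_formula_occurs; eauto.
Qed.

(** * Extending a state by a defining equation for a fresh variable *)

Section FreshDefinition.
Context (c c' : conf Vp Vsym Blk T) (w : Vsym) (e : aexp Vsym).
Context (w_fresh : fresh c w)
  (e_occurs : forall v, avar_in v e -> occurs c v)
  (AL_c' : AL c' = AL c) (PT_c' : PT c' = PT c) (LI_c' : LI c' = LI c)
  (KB_c' : KB c' = Add _ (KB c) (FEq (AVar w) e)).

(** Set [w] to the value of [e] and keep everything else. Since [w] does not occur in [c] while all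
    variables of [e] do, this change affects neither [state_formula c] nor [e]. *)
Lemma model_extend (r : Vsym -> Z) :
  (forall f, state_formula c f -> holds r f) ->
  exists r', (forall v, occurs c v -> r v = r' v) /\
    (forall f, state_formula c f -> holds r' f) /\ r' w = aeval r' e.
Proof.
intros Hr.
pose (r' := fun v =>
  if excluded_middle_informative (v = w) then aeval r e else r v).
assert (E : forall v, occurs c v -> r v = r' v).
{ intros v Hv; unfold r'; destruct excluded_middle_informative as [->|]; auto.
  now elim w_fresh. }
exists r'; split; [exact E|split].
- now apply (models_ext E).
- rewrite <- (aeval_ext (r := r)) by auto.
  unfold r'; now destruct excluded_middle_informative.
Qed.

Lemma state_formula_define f :
  state_formula c' f ->
  forall r, (forall g, state_formula c g -> holds r g) -> r w = aeval r e ->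
  holds r f.
Proof.
intros Hf.
pose (F := fun f => forall r, (forall g, state_formula c g -> holds r g) ->
  r w = aeval r e -> holds r f).
enough (HF : closed c' F) by now apply (Hf F HF).
(* Conservativity: a model of [state_formula c] becomes a model of the equation by a change at [w]
   alone, which a formula over variables of [c] does not see. So the equation triggers no further
   conditional closure clause. *)
assert (down : forall g, (forall v, fvar_in v g -> occurs c v) ->
  entails F g -> entails (state_formula c) g).
{ intros g Hv Hg r Hr.
  destruct (model_extend Hr) as (r' & E & Hr' & Ew).
  apply (holds_ext (r := r')); [intros v Hvg; symmetry; auto|].
  apply Hg; intros h Hh; now apply Hh. }
assert (sub : forall g, state_formula c g -> F g).
{ intros g Hg r Hr _; auto. }
pose proof (state_formula_closed c) as Hc.
split; rewrite ?KB_c', ?AL_c', ?PT_c', ?LI_c'; intros.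
- destruct H as [g Hg|g []]; [now apply sub, (closed_KB Hc)|].
  intros r _ E; exact E.
- now apply sub, (closed_AL Hc).
- now apply sub, (closed_AL_disj Hc).
- now apply sub; apply (closed_PT Hc) in H.
- apply sub, (closed_PT_eq Hc H H0), down; auto.
  apply occurs_PT in H as []; apply occurs_PT in H0 as []; simpl.
  intros v; intuition congruence.
- apply sub, (closed_PT_ne Hc H H0), down; auto.
  apply occurs_PT in H as []; apply occurs_PT in H0 as []; simpl.
  intros v; intuition congruence.
- now apply sub, (closed_LI Hc).
- apply sub, (closed_LI_one Hc H), down; auto.
  apply occurs_LI in H as (? & ? & _); simpl.
  intros v; intuition congruence.
- apply sub, (closed_LI_rec Hc H H0), down; auto.
  apply occurs_LI in H as (? & ? & _); simpl.
  intros v; intuition congruence.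
- apply sub, (closed_LI_two Hc H H0), down; auto.
  apply occurs_LI in H as (_ & _ & H); destruct (H _ H0); simpl.
  intros v; intuition congruence.
Qed.

(** Only [KB] grows, so every set closed for [c'] is also closed for [c]. *)
Lemma state_formula_define_incl f : state_formula c f -> state_formula c' f.
Proof.
intros Hf F HF; apply Hf; destruct HF.
rewrite KB_c', AL_c', PT_c', LI_c' in *.
split; auto.
intros g Hg; apply closed_KB; now left.
Qed.

(** One direction extends models by [model_extend], the other is inclusion of the state formulas.
    Through this equivalence values, memory and the conditions on allocations pass between [c] and
    [c']. *)
Lemma entails_define f :
  (forall v, fvar_in v f -> occurs c v) ->
  entails (state_formula c') f <-> entails (state_formula c) f.
Proof.
intros Hv; split.
- intros Hf r Hr.
  destruct (model_extend Hr) as (r' & E & Hr' & Ew).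
  apply (holds_ext (r := r')); [intros v Hvf; symmetry; auto|].
  apply Hf; intros g Hg; now apply (state_formula_define Hg).
- apply entails_mono, state_formula_define_incl.
Qed.

Lemma has_value_define v n :
  occurs c v -> has_value c' v n <-> has_value c v n.
Proof.
intros Hv; apply entails_define; simpl; intros u [->|[]]; exact Hv.
Qed.

Lemma mem_of_define : mem_of c' = mem_of c.
Proof.
extensionality n; unfold mem_of; f_equal; extensionality m.
apply propositional_extensionality; rewrite PT_c'.
split; intros (w1 & w2 & He & H1 & H2); exists w1, w2;
  destruct (occurs_PT He); (split; [exact He|]);
  now rewrite !has_value_define in *.
Qed.

Lemma satisfiable_define :
  satisfiable (state_formula c) -> satisfiable (state_formula c').
Proof.
intros [r Hr]; destruct (model_extend Hr) as (r' & _ & Hr' & Ew).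
exists r'; intros f Hf; now apply (state_formula_define Hf).
Qed.

Lemma has_value_new n :
  entails (state_formula c) (FEq e (anat n)) -> has_value c' w n.
Proof.
intros He r Hr.
pose proof (closed_KB (state_formula_closed c')) as HK; rewrite KB_c' in HK.
pose proof (Hr _ (HK _ (Union_intror _ _ _ _ (In_singleton _ _)))) as E.
simpl in *; rewrite E; apply He; intros g Hg.
now apply Hr, state_formula_define_incl.
Qed.

(** The variable [w] takes the value [n] of [e]. All other requirements concern entries of [AL] and
    [PT], whose variables occur in [c], and transfer by conservativity. *)
Lemma concrete_define n :
  concrete_conf c -> conf_wf c' ->
  (forall x v, LV c' x = Some v -> v = w \/ occurs c v) ->
  entails (state_formula c) (FEq e (anat n)) -> concrete_conf c'.
Proof.
intros (_ & HLI & Hsat & Hval & Hi8 & HAL & HPT) Hwf HLV He.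
split; [exact Hwf|]; split; [congruence|].
split; [now apply satisfiable_define|].
assert (Hocc : forall v, occurs c' v -> v = w \/ occurs c v).
{ intros v [[x Hx]|[H|[H|[H|(f & Hf & Hv)]]]];
    rewrite ?AL_c', ?PT_c', ?LI_c', ?KB_c' in *.
  - eauto.
  - right; right; now left.
  - right; right; right; now left.
  - right; right; right; right; now left.
  - destruct Hf as [f Hf|f []]; [right; eapply occurs_KB; eauto|].
    destruct Hv as [Hv|Hv]; auto. }
rewrite AL_c', PT_c'; split; [|split; [exact Hi8|split]].
- intros v Hv; destruct (Hocc v Hv) as [->|Hv'].
  + exists n; now apply has_value_new.
  + destruct (Hval v Hv') as [k Hk]; exists k; now apply has_value_define.
- intros v1 v2 k Hv Hk; destruct (occurs_AL Hv).
  apply entails_define in Hk; [|simpl; intuition congruence].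
  destruct (HAL v1 v2 k Hv Hk) as (w1 & w2 & b & H1 & H2 & H3 & H4).
  destruct (occurs_PT H1); exists w1, w2, b.
  now rewrite !has_value_define.
- intros w1 w2 Hw; destruct (HPT w1 w2 Hw) as (v1 & v2 & Hv & H).
  exists v1, v2; split; [exact Hv|].
  destruct (occurs_PT Hw); destruct (occurs_AL Hv).
  apply entails_define; [simpl; intuition congruence|exact H].
Qed.

End FreshDefinition.

(** * Stack and memory of a concrete state *)

Lemma the_nat_intro (Q : nat -> Prop) n :
  (forall k, Q k -> k = n) -> Q n -> the_nat Q = Some n.
Proof.
intros U Hn; unfold the_nat; destruct excluded_middle_informative as [E|E].
- f_equal; apply U, (epsilon_spec (inhabits 0) _ E).
- elim E; now exists n.
Qed.

Lemma the_nat_spec (Q : nat -> Prop) n : the_nat Q = Some n -> Q n.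
Proof.
unfold the_nat; destruct excluded_middle_informative as [E|E]; [|easy].
intros [= <-]; apply (epsilon_spec (inhabits 0) _ E).
Qed.

Lemma has_value_unique c v n k :
  satisfiable (state_formula c) -> has_value c v n -> has_value c v k -> n = k.
Proof.
intros [r Hr] Hn Hk; pose proof (Hn r Hr); pose proof (Hk r Hr).
simpl in *; lia.
Qed.

Lemma as_of_intro c x v n :
  satisfiable (state_formula c) -> LV c x = Some v -> has_value c v n ->
  as_of c x = Some n.
Proof.
intros Hs Hx Hv; apply the_nat_intro; [|now exists v].
intros k (u & Hu & Hk); assert (u = v) by congruence; subst.
eapply has_value_unique; eauto.
Qed.

Lemma as_of_spec c x n :
  as_of c x = Some n -> exists v, LV c x = Some v /\ has_value c v n.
Proof. apply the_nat_spec. Qed.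

Lemma mem_of_zero c : concrete_conf c -> mem_of c 0 = None.
Proof.
intros Hc; destruct (mem_of c 0) as [b|] eqn:E; [|reflexivity].
apply mem_of_range in E; [lia|exact Hc].
Qed.

(** Each number inside an allocation of a concrete state is the address of some byte entry. This
    later places the start of the second list element inside the pointer range. *)
Lemma mem_of_allocated c v1 v2 n1 n2 n :
  concrete_conf c -> AL c (v1, v2) -> has_value c v1 n1 -> has_value c v2 n2 ->
  n1 <= n <= n2 -> mem_of c n <> None.
Proof.
intros (_ & _ & _ & _ & _ & HAL & _) Hv H1 H2 Hn.
destruct (HAL v1 v2 n Hv) as (w1 & w2 & b & Hw & Hw1 & Hw2 & _).
- intros r Hr; pose proof (H1 r Hr); pose proof (H2 r Hr); simpl in *; lia.
- unfold mem_of, the_nat; destruct excluded_middle_informative as [|E]; [easy|].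
  elim E; now exists b, w1, w2.
Qed.

End States.

(** * Monotone assertions and the splitting of memories *)

Section Memory.
Implicit Types (mem : memory) (P Q : assertion).

Definition mincl mem mem' : Prop :=
  forall n b, mem n = Some b -> mem' n = Some b.

(** The block, points-to and list assertions cannot express that an address is undefined, so they
    survive an enlargement of the memory. Shares can thus be read in a larger memory, and leftover
    memory can be assigned to one of them. *)
Definition monotone P : Prop :=
  forall mem mem', mincl mem mem' -> P mem -> P mem'.

Definition munite mem1 mem2 : memory := fun n =>
  match mem1 n with Some b => Some b | None => mem2 n end.

Lemma munion_unite mem1 mem2 :
  (forall n, mem1 n = None \/ mem2 n = None) ->
  munion (munite mem1 mem2) mem1 mem2.
Proof.
intros D; split; [exact D|]; intros n b; unfold munite; specialize (D n).
destruct (mem1 n), (mem2 n); intuition congruence.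
Qed.

Lemma munion_mincl_l mem mem1 mem2 : munion mem mem1 mem2 -> mincl mem1 mem.
Proof. intros [_ H] n b Hb; apply H; now left. Qed.

Lemma munion_mincl_r mem mem1 mem2 : munion mem mem1 mem2 -> mincl mem2 mem.
Proof. intros [_ H] n b Hb; apply H; now right. Qed.

Lemma munion_comm mem mem1 mem2 : munion mem mem1 mem2 -> munion mem mem2 mem1.
Proof.
intros [D H]; split; [intros n; specialize (D n); tauto|].
intros n b; rewrite H; tauto.
Qed.

(** This moves the first list block. Here [m1] belongs to [AL] and [PT], [ml] to the traversed
    invariant and [mo] to the other invariants; [ml] consists of the first block [mb] and the tail
    [mr]. Then [mb] joins [m1], and [mr] joins [mo]. All conditions are checked address by
    address. *)
Lemma munion_regroup mem m1 m2 ml mo mb mr :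
  munion mem m1 m2 -> munion m2 ml mo -> munion ml mb mr ->
  (forall n, m1 n = None \/ mb n = None) /\
  (forall n, mr n = None \/ mo n = None) /\
  munion mem (munite m1 mb) (munite mr mo).
Proof.
intros U1 U2 U3.
pose proof (munion_ext U1) as E1; pose proof (munion_ext U2) as E2.
pose proof (munion_ext U3) as E3.
destruct U1 as [D1 _], U2 as [D2 _], U3 as [D3 _].
unfold munite; split; [|split; [|split]]; intros n;
  specialize (E1 n); specialize (E2 n); specialize (E3 n);
  specialize (D1 n); specialize (D2 n); specialize (D3 n);
  [..|intros b]; rewrite ?E1;
  destruct (m1 n), (mb n), (mr n), (mo n);
  rewrite ?E3 in *; rewrite ?E2 in *; intuition congruence.
Qed.

Lemma star_monotone P Q : monotone Q -> monotone (star P Q).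
Proof.
intros HQ mem mem' I (m1 & m2 & U & HP & H2).
pose proof (munion_ext U) as E; destruct U as [D U].
(* The first factor keeps its share; all additional memory goes to the second, monotone one. *)
exists m1, (fun n => match m1 n with Some _ => None | None => mem' n end).
split; [split|split]; [..|exact HP|].
- intros n; destruct (m1 n); auto.
- intros n b; destruct (m1 n) as [b'|] eqn:E1; [|intuition congruence].
  rewrite (I n b') by (apply U; now left); intuition congruence.
- apply (HQ m2); [|exact H2].
  intros n b Hb; destruct (D n) as [Hn|Hn]; [|congruence].
  rewrite Hn; apply I, U; now right.
Qed.

Lemma block_monotone n1 n2 : monotone (block n1 n2).
Proof.
intros mem mem' I H x; destruct (H x) as [y Hy]; exists y; auto.
Qed.

(** Only the [k] bytes from [n1] on are read, so agreement on this range is enough. This is what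
    localizes a field to the block that contains it. *)
Lemma points_to_ext k n1 n2 mem mem' :
  (forall x b, n1 <= x < n1 + k -> mem x = Some b -> mem' x = Some b) ->
  points_to k n1 n2 mem -> points_to k n1 n2 mem'.
Proof.
revert n1 n2; induction k as [|k IH]; intros n1 n2 E; [easy|].
intros [H1 H2]; split; [apply E; [lia|exact H1]|].
apply IH; [|exact H2]; intros x b Hx; apply E; lia.
Qed.

Lemma points_to_monotone k n1 n2 : monotone (points_to k n1 n2).
Proof. intros mem mem' I; apply points_to_ext; auto. Qed.

Lemma points_to_defined k n1 n2 mem :
  0 < k -> points_to k n1 n2 mem -> exists b, mem n1 = Some b.
Proof. destruct k; [lia|]; intros _ [H _]; eauto. Qed.

(** The [k] bytes are the lowest base 256 digits of the stored number, and below [2 ^ (8 * k)] these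
    digits determine it. Induction peels off the lowest digit. *)
Lemma points_to_inj k n1 n2 n2' mem :
  points_to k n1 n2 mem -> points_to k n1 n2' mem ->
  n2 < 2 ^ (8 * k) -> n2' < 2 ^ (8 * k) -> n2 = n2'.
Proof.
revert n1 n2 n2'; induction k as [|k IH]; intros n1 n2 n2' H H' L L'.
{ change (2 ^ (8 * 0)) with 1 in *; lia. }
cbn [points_to] in H, H'.
replace (8 * S k) with (8 + 8 * k) in L, L' by lia.
rewrite Nat.pow_add_r in L, L'.
assert (Z : 2 ^ 8 <> 0) by now apply Nat.pow_nonzero.
(* From here on the argument works for any nonzero base [B]. *)
revert H H' L L' Z; generalize (2 ^ 8); intros B [H1 H2] [H1' H2'] L L' Z.
assert (Q : n2 / B = n2' / B)
  by (apply (IH (n1 + 1)); auto using Nat.Div0.div_lt_upper_bound).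
pose proof (Nat.div_mod_eq n2 B); pose proof (Nat.div_mod_eq n2' B).
congruence.
Qed.

Lemma cells_at_monotone n fs : monotone (cells_at n fs).
Proof.
intros mem mem' I; apply Forall_impl; intros f.
now apply points_to_monotone.
Qed.

Lemma li_monotone bs j len n fs : monotone (li bs j len n fs).
Proof.
revert n fs; induction len as [|[|len] IH]; intros n fs; [easy|..].
- intros mem mem' I (H1 & H2 & H3); split; [|split]; auto.
  + eapply block_monotone; eauto.
  + eapply cells_at_monotone; eauto.
- intros mem mem' I [(fj & ms & H1 & H2 & H3) H4]; split.
  + exists fj, ms; split; [|split]; auto.
    eapply star_monotone; eauto.
  + eapply cells_at_monotone; eauto.
Qed.

Lemma li_head_defined bs j len n fs mem :
  0 < bs -> li bs j len n fs mem -> exists b, mem n = Some b.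
Proof.
intros Hbs; destruct len as [|[|len]]; [easy|..].
- intros [H _]; destruct (H n) as [b Hb]; exists b; apply Hb; lia.
- intros [(_ & _ & _ & _ & m1 & m2 & U & H & _) _].
  destruct (H n) as [b Hb]; exists b.
  apply (munion_mincl_l U), Hb; lia.
Qed.

Lemma bigstar_elem I (A : Ensemble I) (P : I -> assertion) i mem :
  monotone (P i) -> A i -> bigstar A P mem -> P i mem.
Proof.
intros M Ai H; destruct H as (mems & _ & U & H); [now exists i|].
apply (M (mems i)); [|now apply H].
intros n b Hb; apply U; now exists i.
Qed.

(** Everything outside the share of [i] goes to the remaining family. If that family is empty, its
    [bigstar] is true and accepts any memory. *)
Lemma bigstar_subtract I (A : Ensemble I) (P : I -> assertion) i mem :
  A i -> bigstar A P mem -> star (P i) (bigstar (Subtract I A i) P) mem.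
Proof.
intros Ai H; destruct H as (mems & D & U & H); [now exists i|].
exists (mems i), (fun n => match mems i n with
                           | Some _ => None | None => mem n end).
split; [split|split].
- intros n; destruct (mems i n); auto.
- intros n b; destruct (mems i n) as [b'|] eqn:E; [|intuition congruence].
  rewrite (proj2 (U n b')) by (now exists i); intuition congruence.
- now apply H.
- intros _; exists mems; split; [|split].
  + intros k k' n [Hk _] [Hk' _]; now apply D.
  + intros n b; destruct (mems i n) as [b'|] eqn:E; split.
    * discriminate.
    * intros (k & [Hk Hne] & Hb).
      destruct (D i k n) as [|]; try congruence; auto.
      intros ->; apply Hne; constructor.
    * intros Hb; apply U in Hb as (k & Hk & Hb); exists k.
      split; [split; [exact Hk|]|exact Hb].
      intros K; destruct K; congruence.
    * intros (k & [Hk _] & Hb); apply U; now exists k.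
  + intros k [Hk _]; now apply H.
Qed.

(** This also covers an empty [A]: the second factor is then plain truth and may hold arbitrary
    memory, which the monotone [P a] absorbs. *)
Lemma bigstar_add_monotone I (A : Ensemble I) (P : I -> assertion) a mem :
  monotone (P a) -> ~ A a ->
  star (P a) (bigstar A P) mem -> bigstar (Add I A a) P mem.
Proof.
intros M Ha HS; destruct (classic (exists i, A i)) as [E|E].
- now apply bigstar_add.
- destruct HS as (m1 & m2 & U & H & _).
  apply munion_mincl_l in U; pose proof (M _ _ U H) as HP.
  assert (only : forall i, Add I A a i -> i = a).
  { intros i [k Hk|k []]; [|easy]; elim E; now exists k. }
  intros _; exists (fun _ => mem); split; [|split].
  + intros i k n Hi Hk; rewrite (only i Hi), (only k Hk); tauto.
  + intros n b; split; [|now intros (_ & _ & ?)].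
    exists a; split; [right; constructor|easy].
  + intros i Hi; now rewrite (only i Hi).
Qed.

End Memory.

(** * Valuations of fresh variables and lists of pairs *)

(** Provides the extended valuation: distinct variables can be assigned one after the other without
    overwriting an earlier choice. *)
Lemma override_distinct V (g : V -> nat) vs ns :
  NoDup vs -> length vs = length ns ->
  exists g', map g' vs = ns /\ forall v, ~ List.In v vs -> g' v = g v.
Proof.
intros H; revert ns; induction H as [|u vs Hu _ IH];
  intros [|n ns] L; try discriminate; [now exists g|].
injection L as L; destruct (IH ns L) as (g' & E & Eg).
exists (fun v => if excluded_middle_informative (v = u) then n else g' v).
split; simpl.
- f_equal; [now destruct excluded_middle_informative|].
  rewrite <- E; apply map_ext_in; intros v Hv.
  destruct excluded_middle_informative as [->|]; tauto.
- intros v Hv; rewrite <- Eg by tauto.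
  destruct excluded_middle_informative as [->|]; tauto.
Qed.

Lemma app_inj_length A (xs xs' ys ys' : list A) :
  length xs = length xs' -> xs ++ ys = xs' ++ ys' -> xs = xs' /\ ys = ys'.
Proof.
revert xs'; induction xs as [|x xs IH]; intros [|x' xs'] L E; try easy.
injection E as -> E; injection L as L; destruct (IH xs' L E); now subst.
Qed.

Lemma map_eq_combine A B (f : A -> nat) (g : B -> nat) xs ys x y :
  map g ys = map f xs -> List.In (x, y) (combine xs ys) -> g y = f x.
Proof.
revert ys; induction xs as [|a xs IH]; intros [|b ys] E H; try easy.
injection E as E1 E2; destruct H as [[= <- <-]|H]; [exact E1|eauto].
Qed.

(** * List invariants under a valuation and under the traversal rule *)

Section Traversal.
Context {Vp Vsym Blk : Type} {T : llvm_types}.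
Implicit Types (c s : conf Vp Vsym Blk T) (v w : Vsym).

(** The semantic source of the list clauses of the state formula. Each list element begins with a
    defined byte, so [mem 0 = None] makes its address positive; a list of length one has equal first
    and last values by definition. *)
Lemma li_SL_facts (g : Vsym -> nat) (k : @list_inv Vsym T) mem :
  mem 0 = None -> li_SL g k mem ->
  1 <= g (li_len k) /\ 1 <= g (li_ad k) /\
  (g (li_len k) = 1 -> forall f, List.In f (li_fields k) ->
     g (fld_first f) = g (fld_last f)) /\
  (2 <= g (li_len k) -> forall f, nth_error (li_fields k) (li_rec k) = Some f ->
     1 <= g (fld_first f)).
Proof.
intros M0 H; unfold li_SL in H; pose proof (size_pos (li_ty k)) as Hs.
assert (pos : forall m n, mincl m mem -> (exists b, m n = Some b) -> 1 <= n).
{ intros m [|n] I [b Hb]; [rewrite (I _ _ Hb) in M0; discriminate|lia]. }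
split; [|split; [|split]].
- destruct (g (li_len k)); [easy|lia].
- apply (pos mem); [easy|now apply li_head_defined in H].
- intros E f Hf; rewrite E in H; destruct H as (_ & H & _).
  rewrite Forall_map, Forall_forall in H; exact (H f Hf).
- intros L f Hf; destruct (g (li_len k)) as [|[|len]]; [lia..|].
  destruct H as [(fj & ms & H1 & _ & m1 & m2 & U & _ & H) _].
  rewrite nth_error_map, Hf in H1; injection H1 as <-.
  apply (pos m2); [eapply munion_mincl_r; eauto|].
  now apply li_head_defined in H.
Qed.

Lemma li_SL_ext (g g' : Vsym -> nat) (k : @list_inv Vsym T) :
  g (li_ad k) = g' (li_ad k) -> g (li_len k) = g' (li_len k) ->
  (forall f, List.In f (li_fields k) ->
     g (fld_first f) = g' (fld_first f) /\ g (fld_last f) = g' (fld_last f)) ->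
  li_SL g k = li_SL g' k.
Proof.
intros E1 E2 E; unfold li_SL; rewrite E1, E2; f_equal.
apply map_ext_in; intros f Hf; destruct (E f Hf); congruence.
Qed.

Definition cells_of (g : Vsym -> nat) (fs : list (@field Vsym T)) : list cell :=
  map (fun f => Cell (fld_off f) (size (fld_ty f))
                     (g (fld_first f)) (g (fld_last f))) fs.

Definition set_firsts (fs : list cell) (ms : list nat) : list cell :=
  map (fun fm => set_first (fst fm) (snd fm)) (combine fs ms).

(** Convertible to the new invariant of [list_traversal]; the next definition is convertible to its
    resulting state. *)
Definition traversed_li (l : @list_inv Vsym T) (wstart wlen : Vsym)
  (ws : list Vsym) : @list_inv Vsym T :=
  ListInv wstart wlen (li_ty l)
    (map (fun fw => let (f, w) := fw : @field Vsym T * Vsym in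
            Field (fld_off f) (fld_ty f) w (fld_last f))
         (combine (li_fields l) ws))
    (li_rec l).

Definition traversed s (pb : Vp) (l : @list_inv Vsym T) (fj : @field Vsym T)
  (vstart vend wstart wlen wstartj : Vsym) (vstarts ws : list Vsym)
  : conf Vp Vsym Blk T :=
  Conf
    (next (pos s))
    (update (LV s) pb wstartj)
    (Add _ (AL s) (vstart, vend))
    (Union _ (PT s) (fun e => List.In e
       (map (fun fv => let (f, v) := fv : @field Vsym T * Vsym in
               PtEntry v (fld_ty f) (fld_first f))
            (combine (li_fields l) vstarts))))
    (Add _ (Subtract _ (LI s) l) (traversed_li l wstart wlen ws))
    (Union _ (KB s) (fun f => List.In f
       ([FEq (AVar vstart) (AVar (li_ad l));
         FEq (AVar vend)
             (ASub (AAdd (AVar vstart) (anat (size (li_ty l)))) (anat 1));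
         FEq (AVar wstart) (AVar (fld_first fj));
         FEq (AVar wlen) (ASub (AVar (li_len l)) (anat 1));
         FEq (AVar wstartj) (AAdd (AVar wstart) (anat (fld_off fj)))] ++
        map (fun fv => let (f, v) := fv : @field Vsym T * Vsym in
               FEq (AVar v) (AAdd (AVar (li_ad l)) (anat (fld_off f))))
            (combine (li_fields l) vstarts)))).

Lemma nth_error_traversed (l : @list_inv Vsym T) wstart wlen ws k f :
  length ws = length (li_fields l) ->
  nth_error (li_fields (traversed_li l wstart wlen ws)) k = Some f ->
  exists f0, nth_error (li_fields l) k = Some f0 /\
    fld_off f = fld_off f0 /\ fld_ty f = fld_ty f0.
Proof.
simpl; generalize (li_fields l) as fs; intros fs; revert fs ws.
induction k as [|k IH]; intros [|f0 fs] [|w ws] L H; try discriminate;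
  simpl in *.
- injection H as <-; now exists f0.
- injection L as L; eauto.
Qed.

Lemma nth_error_traversed_some (l : @list_inv Vsym T) wstart wlen ws k f0 :
  length ws = length (li_fields l) -> nth_error (li_fields l) k = Some f0 ->
  exists f, nth_error (li_fields (traversed_li l wstart wlen ws)) k = Some f.
Proof.
intros L H.
destruct (nth_error (li_fields (traversed_li l wstart wlen ws)) k)
  as [f|] eqn:E; [now exists f|].
apply nth_error_None in E; simpl in E.
rewrite length_map, length_combine, L, Nat.min_id in E.
apply nth_error_None in E; congruence.
Qed.

Lemma li_wf_traversed (l : @list_inv Vsym T) wstart wlen ws :
  length ws = length (li_fields l) -> li_wf l ->
  li_wf (traversed_li l wstart wlen ws).
Proof.
intros L [(f0 & H0 & Ty) U]; split.
- destruct (nth_error_traversed_some wstart wlen L H0) as [f Hf].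
  exists f; split; [exact Hf|].
  destruct (nth_error_traversed L Hf) as (f1 & H1 & _ & ->).
  simpl in *; congruence.
- intros k f Hf E; destruct (nth_error_traversed L Hf) as (f1 & H1 & _ & Ef).
  apply (U k f1 H1); simpl in *; congruence.
Qed.

Lemma update_injective (f : Vp -> option Vsym) x0 w :
  (forall x, f x <> Some w) ->
  (forall x y v, f x = Some v -> f y = Some v -> x = y) ->
  forall x y v, update f x0 w x = Some v -> update f x0 w y = Some v -> x = y.
Proof.
intros Hw Hf x y v; unfold update.
destruct (excluded_middle_informative (x = x0)),
  (excluded_middle_informative (y = x0)); intros Hx Hy;
  try (injection Hx as <-); try (injection Hy as <-); subst;
  try easy; try (now elim (Hw x)); try (now elim (Hw y)); eauto.
Qed.

(** * The traversed state holds under the extended valuation *)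

Section Step.
Context (s : conf Vp Vsym Blk T) (sg sg' : Vsym -> nat) (pb : Vp)
  (l : @list_inv Vsym T) (fj : @field Vsym T)
  (vstart vend wstart wlen wstartj : Vsym) (vstarts ws : list Vsym)
  (ms : list nat) (m1 mb mr mo : memory).

Let s' := traversed s pb l fj vstart vend wstart wlen wstartj vstarts ws.
Let l' := traversed_li l wstart wlen ws.

Context (s_wf : conf_wf s) (l_in : LI s l)
  (fj_rec : nth_error (li_fields l) (li_rec l) = Some fj)
  (len_ws : length ws = length (li_fields l))
  (len_ms : length ms = length (li_fields l))
  (vstart_fresh : fresh s vstart) (wstart_fresh : fresh s wstart)
  (wstartj_fresh : fresh s wstartj)
  (sg'_old : forall v, occurs s v -> sg' v = sg v)
  (sg'_new :
    sg' vstart = sg (li_ad l) /\ sg' vend = sg (li_ad l) + size (li_ty l) - 1 /\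
    sg' wstart = sg (fld_first fj) /\ sg' wlen = sg (li_len l) - 1 /\
    sg' wstartj = sg (fld_first fj) + fld_off fj /\
    map sg' vstarts = map (fun f => sg (li_ad l) + fld_off f) (li_fields l) /\
    map sg' ws = ms).

Lemma conf_wf_traversed : conf_wf s'.
Proof.
destruct s_wf as [Hinj Hli]; split.
- apply update_injective; [|exact Hinj].
  intros x Hx; apply wstartj_fresh.
  eapply occurs_LV; eauto.
- intros k [k' [Hk _]|k' []]; [auto|].
  apply li_wf_traversed; auto.
Qed.

Lemma li_SL_old k : LI s k -> li_SL sg' k = li_SL sg k.
Proof.
intros Hk; destruct (occurs_LI Hk) as (H1 & H2 & H).
apply li_SL_ext; [now apply sg'_old..|].
intros f Hf; destruct (H f Hf); split; now apply sg'_old.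
Qed.

(** The fresh first values evaluate to [ms], the witnesses chosen when the list predicate is
    unfolded once; offsets, types and last values stay. Hence the new invariant describes exactly
    the tail of that unfolding. *)
Lemma cells_traversed :
  cells_of sg' (li_fields l') = set_firsts (cells_of sg (li_fields l)) ms.
Proof.
destruct sg'_new as (_ & _ & _ & _ & _ & _ & E).
assert (H : forall f, List.In f (li_fields l) ->
                      sg' (fld_last f) = sg (fld_last f)).
{ intros f Hf; apply sg'_old, (occurs_LI l_in), Hf. }
unfold cells_of, set_firsts, l'; simpl; revert E H len_ws len_ms.
generalize sg' (li_fields l) ws ms; clear; intros g fs.
induction fs as [|f fs IH]; intros [|u us] [|n ns] E H L1 L2;
  try discriminate; [reflexivity|].
injection E as E1 E2; simpl; f_equal.
- unfold set_first; simpl; rewrite E1, (H f); [reflexivity|now left].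
- apply IH; auto with datatypes.
Qed.

Context (sg_state : forall f, state_formula s f ->
                              holds (fun v => Z.of_nat (sg v)) f)
  (s_values : values_agree sg s)
  (len_ge_2 : 2 <= sg (li_len l))
  (disj_m1_mb : forall n, m1 n = None \/ mb n = None)
  (zero_mr : mr 0 = None) (zero_mo : mo 0 = None)
  (disj_mr_mo : forall n, mr n = None \/ mo n = None)
  (AL_m1 : bigstar (AL s) (alloc_SL sg) m1)
  (PT_m1 : forall e, PT s e -> pt_SL sg e m1)
  (head_mb : block (sg (li_ad l)) (sg (li_ad l) + size (li_ty l) - 1) mb)
  (cells_mb : forall f, List.In f (li_fields l) ->
     points_to (size (fld_ty f)) (sg (li_ad l) + fld_off f) (sg (fld_first f))
       mb)
  (rest_mr : li (size (li_ty l)) (li_rec l) (sg (li_len l) - 1)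
     (sg (fld_first fj))
     (set_firsts (cells_of sg (li_fields l)) ms)
     mr)
  (LI_mo : bigstar (Subtract _ (LI s) l) (li_SL sg) mo).

Lemma li_SL_traversed : li_SL sg' l' mr.
Proof.
change (li (size (li_ty l)) (li_rec l) (sg' wlen) (sg' wstart)
          (cells_of sg' (li_fields l')) mr).
rewrite cells_traversed.
destruct sg'_new as (_ & _ & -> & -> & _); exact rest_mr.
Qed.

(** Brings each invariant into the form needed by [li_SL_facts]: old ones are satisfied in [mo], the
    new one in [mr]. *)
Lemma LI_traversed k : LI s' k -> exists mem, mem 0 = None /\ li_SL sg' k mem.
Proof.
intros [k' Hk|k' []]; [exists mo|exists mr].
- split; [exact zero_mo|].
  rewrite li_SL_old by apply Hk.
  apply (bigstar_elem (P := li_SL sg) (A := Subtract _ (LI s) l)); auto.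
  apply li_monotone.
- split; [exact zero_mr|apply li_SL_traversed].
Qed.

Lemma PT_traversed (v1 : Vsym) (a : T) (v2 : Vsym) :
  PT s' (PtEntry v1 a v2) ->
  (PT s (PtEntry v1 a v2) /\ sg' v1 = sg v1 /\ sg' v2 = sg v2) \/
  exists f, List.In f (li_fields l) /\ a = fld_ty f /\
    sg' v1 = sg (li_ad l) + fld_off f /\ v2 = fld_first f /\
    sg' v2 = sg (fld_first f).
Proof.
intros H; apply Union_inv in H as [He|He]; [left|right].
- destruct (occurs_PT He); auto using sg'_old.
- apply in_map_iff in He as ([f v] & [= <- <- <-] & Hf).
  destruct sg'_new as (_ & _ & _ & _ & _ & E & _).
  exists f; rewrite (map_eq_combine E Hf); apply in_combine_l in Hf.
  repeat split; auto; apply sg'_old, (occurs_LI l_in), Hf.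
Qed.

Lemma PT_SL_traversed e : PT s' e -> pt_SL sg' e (munite m1 mb).
Proof.
destruct e as [v1 a v2]; intros He; unfold pt_SL; simpl.
destruct (PT_traversed He) as [(H & -> & ->)|(f & Hf & -> & -> & _ & ->)].
- apply PT_m1 in H; revert H; apply points_to_monotone.
  apply (munion_mincl_l (munion_unite disj_m1_mb)).
- generalize (cells_mb Hf); apply points_to_monotone.
  apply (munion_mincl_r (munion_unite disj_m1_mb)).
Qed.

(** Serves both conditional points-to clauses. Two old or two new entries are covered by
    [values_agree]; an old and a new one never share an address, because the first byte of the old
    one lies in [m1] and that of the new one in [mb]. *)
Lemma PT_agree (a : T) (v1 v2 w1 w2 : Vsym) :
  PT s' (PtEntry v1 a v2) -> PT s' (PtEntry w1 a w2) ->
  sg' v1 = sg' w1 -> sg' v2 = sg' w2.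
Proof.
assert (apart : forall u1 u2 f, PT s (PtEntry u1 (fld_ty f) u2) ->
  List.In f (li_fields l) -> sg u1 <> sg (li_ad l) + fld_off f).
{ intros u1 u2 f Hu Hf E; apply PT_m1 in Hu; apply cells_mb in Hf.
  apply points_to_defined in Hu as [b Hb]; [|apply size_pos].
  apply points_to_defined in Hf as [b' Hb']; [|apply size_pos].
  simpl in Hb; rewrite E in Hb.
  destruct (disj_m1_mb (sg (li_ad l) + fld_off f)); congruence. }
destruct s_values as [agree_PT agree_LI]; intros Hv Hw.
destruct (PT_traversed Hv) as [(H & -> & ->)|(f & Hf & -> & -> & _ & ->)];
destruct (PT_traversed Hw) as [(H' & -> & ->)|(g & Hg & Tg & -> & _ & ->)].
- now apply agree_PT with a.
- subst a; intros E; now elim (apart _ _ _ H Hg).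
- intros E; now elim (apart _ _ _ H' Hf).
- intros E; apply (agree_LI l); auto; lia.
Qed.

Lemma vstart_le_vend :
  1 <= sg (li_ad l) /\
  sg (li_ad l) <= sg (li_ad l) + size (li_ty l) - 1.
Proof.
pose proof (size_pos (li_ty l)).
pose proof (sg_state (closed_LI (state_formula_closed s) l_in)) as H1.
simpl in H1; lia.
Qed.

Lemma blocks_apart v1 v2 n1 n2 :
  AL s (v1, v2) -> sg v1 <= sg v2 -> n1 <= n2 -> block n1 n2 mb ->
  sg v2 < n1 \/ n2 < sg v1.
Proof.
intros Hv L1 L2 B2.
assert (B1 : block (sg v1) (sg v2) m1).
{ apply (bigstar_elem (P := alloc_SL sg) (i := (v1, v2)) (A := AL s)); auto.
  apply block_monotone. }
destruct (Nat.lt_ge_cases (sg v2) n1); [now left|].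
destruct (Nat.lt_ge_cases n2 (sg v1)); [now right|].
(* Overlapping intervals share the larger of their two starts, which would then be defined in both
   [m1] and [mb]. *)
destruct (B1 (max (sg v1) n1)) as [b1 Hb1], (B2 (max (sg v1) n1)) as [b2 Hb2].
destruct (disj_m1_mb (max (sg v1) n1)) as [E|E];
  [rewrite Hb1 in E|rewrite Hb2 in E]; try discriminate; lia.
Qed.

Lemma AL_traversed v1 v2 :
  AL s' (v1, v2) ->
  (AL s (v1, v2) /\ sg' v1 = sg v1 /\ sg' v2 = sg v2) \/
  (v1 = vstart /\ v2 = vend /\ sg' v1 = sg (li_ad l) /\
   sg' v2 = sg (li_ad l) + size (li_ty l) - 1).
Proof.
intros H; apply Add_inv in H as [Ha|[= <- <-]].
- destruct (occurs_AL Ha); auto using sg'_old.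
- destruct sg'_new as (? & ? & _); auto.
Qed.

Lemma KB_traversed f : KB s' f -> holds (fun v => Z.of_nat (sg' v)) f.
Proof.
destruct sg'_new as (E1 & E2 & E3 & E4 & E5 & E6 & _).
destruct (occurs_LI l_in) as (O1 & O2 & O3); apply sg'_old in O1, O2.
destruct (O3 _ (nth_error_In _ _ fj_rec)) as [O4 _]; apply sg'_old in O4.
(* Together with [len_ge_2], positivity of the size makes the truncated subtractions in [sg'_new]
   agree with the integer ones in [KB]. *)
pose proof (size_pos (li_ty l)).
intros [g Hg|g Hg].
- apply (holds_ext (r := fun v => Z.of_nat (sg v))).
  + intros v Hv; rewrite sg'_old; [reflexivity|eapply occurs_KB; eauto].
  + apply sg_state, (closed_KB (state_formula_closed s)), Hg.
- apply in_app_or in Hg as [Hg|Hg].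
  + simpl in Hg; decompose [or] Hg; subst; try easy; simpl; lia.
  + apply in_map_iff in Hg as ([fd v] & <- & Hf).
    simpl; rewrite (map_eq_combine E6 Hf); lia.
Qed.

(* The set of formulas true under [sg'] is closed: entailment from it is truth,
   so each conditional clause becomes an implication between values. *)
Lemma state_formula_traversed f :
  state_formula s' f -> holds (fun v => Z.of_nat (sg' v)) f.
Proof.
intros Hf; apply (Hf (fun f => holds (fun v => Z.of_nat (sg' v)) f)).
assert (models : forall g,
  entails (fun f => holds (fun v => Z.of_nat (sg' v)) f) g ->
  holds (fun v => Z.of_nat (sg' v)) g) by (intros g Hg; now apply Hg).
destruct vstart_le_vend as [pos_ad le_ad].
assert (AL_le : forall v1 v2, AL s (v1, v2) -> 1 <= sg v1 <= sg v2).
{ intros v1 v2 H; apply (closed_AL (state_formula_closed s)), sg_state in H.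
  simpl in H; lia. }
split.
- apply KB_traversed.
- intros v1 v2 Hv; simpl.
  destruct (AL_traversed Hv) as [(H & -> & ->)|(_ & _ & -> & ->)]; [|lia].
  apply AL_le in H; lia.
- intros v1 v2 w1 w2 Hv Hw Ne; simpl.
  destruct (AL_traversed Hv) as [(H & -> & ->)|(-> & -> & -> & ->)];
  destruct (AL_traversed Hw) as [(H' & -> & ->)|(-> & -> & -> & ->)].
  + pose proof (sg_state
      (closed_AL_disj (state_formula_closed s) H H' Ne)) as D.
    simpl in D; lia.
  + destruct (AL_le _ _ H).
    destruct (blocks_apart H (n1 := sg (li_ad l))
      (n2 := sg (li_ad l) + size (li_ty l) - 1)); auto; lia.
  + destruct (AL_le _ _ H').
    destruct (blocks_apart H' (n1 := sg (li_ad l))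
      (n2 := sg (li_ad l) + size (li_ty l) - 1)); auto; lia.
  + now elim Ne.
- intros v1 a v2 Hv; simpl.
  destruct (PT_traversed Hv) as [(H & -> & _)|(f0 & _ & _ & -> & _)]; [|lia].
  apply (closed_PT (state_formula_closed s)), sg_state in H; exact H.
- intros a v1 v2 w1 w2 Hv Hw H; apply models in H; simpl in *.
  f_equal; apply (PT_agree Hv Hw); lia.
(* For truth under a single valuation this clause is the contrapositive of the preceding one. *)
- intros a v1 v2 w1 w2 Hv Hw H; apply models in H; simpl in *.
  intros E; apply H; f_equal; apply (PT_agree Hv Hw); lia.
- intros k Hk; destruct (LI_traversed Hk) as (mem & M0 & Hmem).
  destruct (li_SL_facts M0 Hmem); simpl; lia.
- intros k Hk H; destruct (LI_traversed Hk) as (mem & M0 & Hmem).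
  destruct (li_SL_facts M0 Hmem) as (_ & _ & F & _).
  apply models in H; simpl in H.
  apply holds_FConj; rewrite Forall_map, Forall_forall; intros f0 Hf0; simpl.
  rewrite F; auto; lia.
- intros k f0 Hk Hf0 H; destruct (LI_traversed Hk) as (mem & M0 & Hmem).
  destruct (li_SL_facts M0 Hmem) as (_ & _ & _ & F).
  apply models in H; simpl in *.
  assert (1 <= sg' (fld_first f0)) by (apply F; auto; lia); lia.
- intros k f0 Hk Hf0 H; destruct (LI_traversed Hk) as (mem & M0 & Hmem).
  destruct (li_SL_facts M0 Hmem) as (L & _ & F & _).
  apply models in H; simpl in *.
  (* Length one would make first and last values equal, against [H]. *)
  destruct (Nat.eq_dec (sg' (li_len k)) 1) as [E|]; [|lia].
  elim H; rewrite (F E); auto.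
Qed.

(** The new allocation owns [mb] beside the old ones in [m1], and the new invariant owns [mr] beside
    the remaining ones in [mo]. Freshness of [vstart] and [wstart] ensures that neither was present
    before, so each really adds a factor. *)
Lemma star_traversed mem :
  munion mem (munite m1 mb) (munite mr mo) ->
  star (fun mem1 => bigstar (AL s') (alloc_SL sg') mem1 /\
                    forall e, PT s' e -> pt_SL sg' e mem1)
       (bigstar (LI s') (li_SL sg')) mem.
Proof.
intros U; exists (munite m1 mb), (munite mr mo).
split; [exact U|split; [split|]].
- apply bigstar_add_monotone; [apply block_monotone|..].
  + intros H; apply vstart_fresh.
    now apply occurs_AL in H.
  + exists mb, m1; split; [now apply munion_comm, munion_unite|split].
    * destruct sg'_new as (E1 & E2 & _); unfold alloc_SL; simpl.
      rewrite E1, E2; exact head_mb.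
    * intros NE; destruct (AL_m1 NE) as (mems & D & Hu & H).
      exists mems; split; [exact D|split; [exact Hu|]].
      intros [v1 v2] Hv; destruct (occurs_AL Hv); unfold alloc_SL; simpl.
      rewrite !sg'_old by easy; now apply (H (v1, v2)).
- apply PT_SL_traversed.
- apply bigstar_add_monotone; [apply li_monotone|..].
  + intros [H _]; apply wstart_fresh.
    now apply (occurs_LI H).
  + exists mr, mo; split; [now apply munion_unite|split].
    * apply li_SL_traversed.
    * intros NE; destruct (LI_mo NE) as (mems & D & Hu & H).
      exists mems; split; [exact D|split; [exact Hu|]].
      intros k Hk; rewrite li_SL_old by apply Hk; auto.
Qed.

End Step.
End Traversal.

(** * The traversed state represents the concrete successor *)

Theorem theorem4 (Vp Vsym Blk : Type) (T : llvm_types)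
  (infinite_Vp : ~ Finite Vp) (infinite_Vsym : ~ Finite Vsym)
  (P : program Vp Blk)
  (pb pa : Vp) (m : nat) (t : operand Vp)
  (s s' c c' : conf Vp Vsym Blk T) (sg : Vsym -> nat)
  (instr_s : P (pos s) = Some (GetElementPtr pb pa m t))
  (c_represented : represented_via sg c s)
  (s_fields : fields_inside s)
  (s_values : values_agree sg s)
  (c_addresses : addresses_fit c)
  (s_step : list_traversal pb pa t s s')
  (c_step : concrete_gep pb pa t c c') :
  represented (Proper c') (Proper s').
Proof.
cbv zeta in s_step.
destruct s_step as (l & fj & a & tt & vstart & vend & wstart & wlen & wstartj &
  vstarts & ws & Hl & Hfj & Ha & Eaf & Ht & Etoff & Elen & Lv & Lw &
  [ND Fr] & ->).
destruct c_step as (ca & ctt & w & c_LI & Hca & Hct & w_fresh & ->).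
destruct c_represented as (c_conc & s_wf & Epos & Edom & (s_models & s_LV & m1 &
  m2 & U1 & [AL_m1 PT_m1] & LI_m2) & s_AL & s_LI).
apply (bigstar_subtract Hl) in LI_m2 as (ml & mo & U2 & li_ml & LI_mo).
(* As [sg] satisfies [state_formula s], the entailments required by the rule become facts about
   values. *)
pose proof (Elen _ s_models) as len_ge_2; simpl in len_ge_2.
apply (Nat2Z.inj_le 2) in len_ge_2.
assert (a_fj : sg a = sg (fld_first fj)).
{ pose proof (Eaf _ s_models) as E; simpl in E; lia. }
assert (mem0 : forall m0, mincl m0 (mem_of c) -> m0 0 = None).
{ intros m0 I; destruct (m0 0) as [b|] eqn:E; [|reflexivity].
  apply I in E; rewrite mem_of_zero in E; easy. }
assert (I2 := munion_mincl_r U1).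
assert (Il : mincl ml (mem_of c)).
{ intros n b Hb; now apply I2, (munion_mincl_l U2). }
assert (Io : mincl mo (mem_of c)).
{ intros n b Hb; now apply I2, (munion_mincl_r U2). }
assert (ty_pos := size_pos (li_ty l)).
(* One unfolding of the list predicate: [mb] carries the first block and [mr] the tail starting at
   the recursive field's value. The fields of the first element are so far known only in the whole
   share [ml]. *)
assert (unfolded : exists ms mb mr, length ms = length (li_fields l) /\
  munion ml mb mr /\
  block (sg (li_ad l)) (sg (li_ad l) + size (li_ty l) - 1) mb /\
  li (size (li_ty l)) (li_rec l) (sg (li_len l) - 1)
     (sg (fld_first fj))
     (set_firsts (cells_of sg (li_fields l)) ms)
     mr /\
  forall f, List.In f (li_fields l) ->
    points_to (size (fld_ty f)) (sg (li_ad l) + fld_off f) (sg (fld_first f))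
      ml).
{ unfold li_SL in li_ml; destruct (sg (li_len l)) as [|[|n]]; [lia..|].
  destruct li_ml as [(f & ms & Hf & Lms & mb & mr & U3 & Hb & Hr) Hcells].
  rewrite nth_error_map, Hfj in Hf; injection Hf as <-.
  rewrite length_map in Lms; exists ms, mb, mr.
  repeat (split; [assumption|]).
  unfold cells_at in Hcells; rewrite Forall_map, Forall_forall in Hcells.
  exact Hcells. }
destruct unfolded as (ms & mb & mr & Lms & U3 & head_mb & rest_mr & cells_ml).
destruct (munion_regroup U1 U2 U3) as (D1 & D2 & U).
(* By [fields_inside] the bytes of a field lie inside the first block, on which [mb] is defined and
   agrees with [ml]. *)
assert (cells_mb : forall f, List.In f (li_fields l) ->
  points_to (size (fld_ty f)) (sg (li_ad l) + fld_off f) (sg (fld_first f)) mb).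
{ intros f Hf; generalize (cells_ml f Hf); apply points_to_ext.
  intros x b Hx Hb; pose proof (s_fields l f Hl Hf).
  destruct (head_mb x) as [b' Hb']; rewrite Hb' by lia.
  rewrite <- Hb; symmetry; apply (munion_mincl_l U3), Hb'; lia. }
assert (Ir : mincl mr (mem_of c)).
{ intros n b Hb; now apply Il, (munion_mincl_r U3). }
(* The values follow the order of the fresh variables in [list_traversal] and are those forced by
   the equations added to [KB]; the [ws] receive [ms]. *)
destruct (override_distinct sg ND (ns := [sg (li_ad l);
  sg (li_ad l) + size (li_ty l) - 1; sg (fld_first fj); sg (li_len l) - 1;
  sg (fld_first fj) + fld_off fj] ++
  map (fun f => sg (li_ad l) + fld_off f) (li_fields l) ++ ms))
  as (sg' & Enew & Eold).
{ simpl; rewrite !length_app, length_map; lia. }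
rewrite !map_app in Enew; cbn [map app] in Enew.
injection Enew as Evstart Evend Ewstart Ewlen Ewstartj Erest.
apply app_inj_length in Erest as [Evstarts Ews];
  [|rewrite !length_map; congruence].
rewrite Forall_forall in Fr.
assert (sg'_old : forall v, occurs s v -> sg' v = sg v).
{ intros v Hv; apply Eold; intros H; now apply (Fr v). }
assert (vstart_fresh : fresh s vstart) by (apply Fr; simpl; tauto).
assert (wstart_fresh : fresh s wstart) by (apply Fr; simpl; tauto).
assert (wstartj_fresh : fresh s wstartj) by (apply Fr; simpl; tauto).
set (e := AAdd (AVar ca) ctt).
(* Under [sg] the operands have their concrete stack values, and [s] entails that they equal the
   recursive field's value and its offset. So the concrete sum is the value given to [wstartj]. *)
assert (e_value : entails (state_formula c)
                    (FEq e (anat (sg (fld_first fj) + fld_off fj)))).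
{ apply s_LV, as_of_spec in Ha as (v & Hv & Hav).
  assert (v = ca) by congruence; subst v.
  assert (Hoff : entails (state_formula c) (FEq ctt (anat (fld_off fj)))).
  { pose proof (Etoff _ s_models) as Eoff; simpl in Eoff.
    destruct t as [x|n]; simpl in Ht, Hct.
    - destruct (LV s x) as [u|] eqn:Hx; [injection Ht as <-|easy].
      apply s_LV, as_of_spec in Hx as (u' & Hu' & Hv').
      rewrite Hu' in Hct; injection Hct as <-; simpl in Eoff.
      apply Nat2Z.inj in Eoff; rewrite <- Eoff; exact Hv'.
    - injection Ht as <-; injection Hct as <-; simpl in Eoff.
      intros r _; exact Eoff. }
  intros r Hr; pose proof (Hav r Hr); pose proof (Hoff r Hr); simpl in *; lia. }
assert (e_occurs : forall v, avar_in v e -> occurs c v).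
{ intros v [->|Hv]; [eapply occurs_LV; eauto|].
  destruct t as [x|n]; simpl in Hct.
  - destruct (LV c x) as [u|] eqn:Hx; [injection Hct as <-|easy].
    simpl in Hv; subst; eapply occurs_LV; eauto.
  - injection Hct as <-; destruct Hv. }
set (c' := Conf _ _ _ _ _ _ : conf Vp Vsym Blk T).
assert (LI_c' : LI c' = LI c) by now symmetry.
assert (c'_conc : concrete_conf c').
{ eapply (concrete_define (c := c) (w := w) (e := e)); eauto.
  - split; [|now rewrite LI_c', c_LI].
    apply update_injective; [|apply c_conc].
    intros x Hx; apply w_fresh; eapply occurs_LV; eauto.
  - intros x v; simpl; unfold update.
    destruct excluded_middle_informative; [intros [= <-]; auto|].
    intros Hx; right; eapply occurs_LV; eauto. }
assert (c'_mem : mem_of c' = mem_of c).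
{ now apply (mem_of_define (w := w) (e := e)). }
assert (c'_value : forall v n, has_value c v n -> has_value c' v n).
{ intros v n; apply entails_mono; intros f.
  now apply (state_formula_define_incl (w := w) (e := e)). }
exists sg'; split; [exact c'_conc|].
split; [|split; [|split; [|split; [|split]]]].
- now apply (conf_wf_traversed pb fj).
- simpl; now rewrite Epos.
- intros x; simpl; unfold update.
  destruct excluded_middle_informative; [easy|apply Edom].
- rewrite c'_mem; split; [|split].
  + eapply (state_formula_traversed (m1 := m1) (mr := mr) (mo := mo)); eauto 10.
  + intros x v; simpl; unfold update.
    destruct excluded_middle_informative as [->|Hx].
    * intros [= <-]; rewrite Ewstartj.
      apply as_of_intro with w; [apply c'_conc|..].
      -- simpl; unfold update; now destruct excluded_middle_informative.
      -- now apply (has_value_new (c := c) (e := e)).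
    * intros Hv; rewrite sg'_old by (eapply occurs_LV; eauto).
      apply s_LV, as_of_spec in Hv as (u & Hu & Huv).
      apply as_of_intro with u; [apply c'_conc|..|auto].
      simpl; unfold update; now destruct excluded_middle_informative.
  + apply (star_traversed (sg := sg) pb (fj := fj) (ms := ms) (mb := mb)
      (m1 := m1) (mr := mr) (mo := mo)); auto 10.
- intros v1 v2 Hv; simpl in Hv; apply Add_inv in Hv as [Hv|[= <- <-]].
  + destruct (occurs_AL Hv); rewrite !sg'_old by easy.
    destruct (s_AL v1 v2 Hv) as (w1 & w2 & ? & ? & ?); exists w1, w2; auto.
  + destruct (s_LI l Hl fj Hfj) as (us & ue & ns & ne & Hal & Ead & _).
    (* The concrete counterpart of the new allocation is the first allocation that the
       representation provides for [l]. *)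
    destruct (Hal 1) as (H1 & H2 & H3 & H4); [lia|].
    exists (us 1), (ue 1); split; [exact H1|].
    rewrite Evstart, Evend, Ead; split; [auto|].
    replace (ns 1 + size (li_ty l) - 1) with (ne 1) by lia; auto.
- intros k Hk; simpl in Hk; apply Add_inv in Hk as [[Hk _]|<-].
  + intros f Hf.
    destruct (s_LI k Hk f Hf) as (us & ue & ns & ne & Hal & Ead & Hp).
    destruct (occurs_LI Hk) as (H1 & H2 & _).
    exists us, ue, ns, ne; rewrite !sg'_old, c'_mem by easy.
    split; [|auto]; intros i Hi; destruct (Hal i Hi) as (? & ? & ? & ?); auto.
  + intros f Hf.
    apply (nth_error_traversed (wstart := wstart) (wlen := wlen) Lw) in Hf
      as (f0 & Hf0 & -> & _).
    assert (f0 = fj) by (simpl in Hf0; congruence); subst f0.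
    destruct (s_LI l Hl fj Hfj) as (us & ue & ns & ne & Hal & Ead & Hp).
    (* The tail begins with the second element, so all allocation indices shift by one. *)
    exists (fun i => us (S i)), (fun i => ue (S i)),
      (fun i => ns (S i)), (fun i => ne (S i)).
    simpl; rewrite Ewlen, Ewstart, c'_mem; split; [|split].
    * intros i Hi; destruct (Hal (S i)) as (? & ? & ? & ?); [lia|auto].
    * pose proof (size_pos (ptr (li_ty l))).
      (* Both numbers are read from the recursive field of the first element: one by the list
         predicate, the other by the chain of allocations. *)
      apply (points_to_inj (k := size (ptr (li_ty l)))
        (n1 := sg (li_ad l) + fld_off fj) (mem := mem_of c)).
      -- destruct s_wf as [_ wf]; destruct (wf l Hl) as [(g & Hg & Tg) _].
         assert (g = fj) by congruence; subst g; rewrite <- Tg.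
         generalize (cells_ml fj (nth_error_In _ _ Hfj)).
         now apply points_to_monotone.
      -- rewrite Ead; apply (Hp 1); lia.
      -- apply c_addresses.
         (* The tail [mr] has a defined byte at its start, so this start is an address of the
            concrete memory. *)
         destruct (li_head_defined ty_pos rest_mr) as [b Hb].
         apply Ir in Hb; congruence.
      -- apply c_addresses.
         destruct (Hal 2) as (? & H1 & H2 & ?); [lia|].
         eapply mem_of_allocated; eauto; lia.
    * intros i Hi; apply (Hp (S i)); lia.
Qed.
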